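(* There exists a constant $C > 0$ such that for every positive integer $n$, every $n$-vertex graph with at least $Cn^{3/2}$ edges contains a cycle with all diagonals; that is, it contains $C^{\mathrm{dia}}_{2\ell}$ as a (not necessarily induced) subgraph for some integer $\ell \ge 2$.
   Context: Graphs are finite and simple. For an integer $\ell \ge 2$, the cycle of length $2\ell$ with all diagonals, denoted $C^{\mathrm{dia}}_{2\ell}$, is the graph with vertex set $\{x_1,\dots,x_{2\ell}\}$ (distinct vertices) whose edges are the edges $x_1x_2, x_2x_3, \dots, x_{2\ell-1}x_{2\ell}, x_{2\ell}x_1$ of the cycle together with the diagonals $x_i x_{i+\ell}$ for $i = 1,\dots,\ell$. *)

(* Defs.v *)
From mathcomp Require Import all_boot.
Set Implicit Arguments.
Unset Strict Implicit.
Unset Printing Implicit Defensive.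

Record sgraph := SGraph {
  vertex :> finType;
  adj : rel vertex;
  adj_sym : symmetric adj;
  adj_irrefl : irreflexive adj }.

Definition edges (G : sgraph) : {set {set G}} :=
  [set [set x; y] | x in G, y in adj x].

(* Not necessarily induced: edges of H go to edges of G, but non-edges of H
   are unconstrained. *)
Definition contains (G H : sgraph) : Prop :=
  exists f : H -> G, injective f /\ forall x y, adj x y -> adj (f x) (f y).

(* The vertices are numbered from 0, so x_(i+1) is i : 'I_(2 * l), and ordS is
   the successor modulo 2 * l.  The last two disjuncts are the diagonals, whose
   end of smaller index is among the first l vertices. *)
Definition cdia_adj (l : nat) : rel 'I_(2 * l) := fun i j =>
  [|| j == ordS i, i == ordS j, j == i + l :> nat | i == j + l :> nat].

Lemma cdia_adj_sym l : symmetric (@cdia_adj l).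
Proof.
by move=> i j; rewrite /cdia_adj orbCA; congr [|| _, _ | _]; rewrite orbC.
Qed.

Lemma cdia_adj_irrefl l : irreflexive (@cdia_adj l).
Proof.
move=> i; have lt_i := ltn_ord i.
have l_gt0 : 0 < l by case: l i lt_i => [|l] // [].
have nS : (i == ordS i) = false.
  apply/eqP => /(congr1 val) /=; case: (ltngtP i.+1 (2 * l)) => [h|h|h].
  - by rewrite modn_small // => /eqP; rewrite eqn_leq ltnn andbF.
  - by move: h; rewrite ltnS leqNgt lt_i.
  - by rewrite h modnn => i0; move: h; rewrite i0 mul2n => /(congr1 odd); rewrite odd_double.
by rewrite /cdia_adj nS /= -[X in X == (i + l)%N]addn0 eqn_add2l ltn_eqF.
Qed.

(* The intended range is 2 <= l; for l = 2 this is the complete graph K_4. *)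
Definition cdia (l : nat) : sgraph :=
  SGraph (@cdia_adj_sym l) (@cdia_adj_irrefl l).

(* Main.v *)
(* Call an ordered pair (a, b) of adjacent vertices a rung, and join (a, b) to
   (a', b') when a b' and a' b are also edges.  A closed walk of odd length l
   through pairwise disjoint rungs is a cycle of length 2l with all diagonals.
   If G contains K_{3,3} we are done with l = 3.  Otherwise pass to a set of rungs
   in which almost all pairs a, a' of neighbours of a vertex b have many common
   neighbours, and consider the symmetric weighted walk S that moves from (a, b)
   to a neighbour a' of b and then to a common neighbour b' of a and a'.

   Its eigenvalues are at most 1, some even traces are nearly as large as if 1
   were an eigenvalue, and all its eigenvalues are at least about -1/2: for X, Y
   the functions of b given by a vector x on (a, b) and (a', b), and E the mean
   over the common neighbours b of a and a', one has
   2 EX EY - E(XY) >= - E(X^2 + Y^2) / 2, and the terms E(XY) add up to a sum of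
   squares.  Hence for l of logarithmic size the trace of S^l is positive and
   comparable with traces of even powers.

   A step of S hits a prescribed vertex with probability O(n^(-1/4)); for b' this
   holds after discarding the pairs b, b' with too many common neighbours, which
   K_{3,3}-freeness makes negligible.  So closed walks with a repeated vertex
   contribute at most O(l^2 n^(-1/4)) times the trace of a power between l/2 and
   l; doubling l a bounded number of times, one finds a length for which the trace
   of that power exceeds the trace of S^l by a small power of n only. *)
Require Import Defs.
From mathcomp Require Import all_boot all_order all_algebra.
From mathcomp Require Import reals exp.
From mathcomp Require Import complex.
From mathcomp Require Import ring lra zify.
Set Implicit Arguments.
Unset Strict Implicit.
Unset Printing Implicit Defensive.
Import Order.TTheory GRing.Theory Num.Theory.
Local Open Scope ring_scope.

(** * Real spectrum of a symmetric matrix *)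

Lemma mxtrace_mulrC (R : comNzRingType) n (A B : 'M[R]_n) :
  \tr (A * B) = \tr (B * A).
Proof. exact: mxtrace_mulC. Qed.

Lemma map_mx_exp (aR rR : nzRingType) (f : {rmorphism aR -> rR}) n
    (A : 'M[aR]_n) k : map_mx f (A ^+ k) = map_mx f A ^+ k.
Proof.
elim: k => [|k IHk]; first by rewrite !expr0 map_mx1.
by rewrite !exprS -!mulmxE map_mxM IHk.
Qed.

Lemma diag_mx_exp (R : nzRingType) n (d : 'rV[R]_n) k :
  diag_mx d ^+ k = diag_mx (\row_i d 0 i ^+ k).
Proof.
elim: k => [|k IHk].
  by rewrite expr0; apply/matrixP=> i j; rewrite !mxE expr0.
rewrite exprS IHk -mulmxE mulmx_diag; congr diag_mx.
by apply/rowP=> i; rewrite !mxE exprS.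
Qed.

Lemma symmetric_mx_eigen (R : rcfType) n (S : 'M[R]_n) : S^T = S ->
  exists lam : 'I_n -> R, (forall k, \tr (S ^+ k) = \sum_i lam i ^+ k) /\
    forall i, exists2 v : 'rV[R]_n, v != 0 & v *m S = lam i *: v.
Proof.
move=> symS; pose f := @real_complex R; pose A := map_mx f S.
have hermA : A \is hermsymmx.
  apply/is_hermitianmxP; rewrite expr0 scale1r; apply/matrixP => i j.
  by have /matrixP/(_ i j) := symS; rewrite !mxE => ->; rewrite conj_Creal // /f complex_real.
have /hermitian_normalmx/orthomx_spectralP defA := hermA.
set U := spectralmx A in defA; set d := spectral_diag A in defA.
have uU : U \in unitmx := spectral_unit A.
have d_real i : d 0 i = f (complex.Re (d 0 i)).
  have /mxOverP/(_ 0 i)/RRe_real := hermitian_spectral_diag_real hermA.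
  by move/esym.
have powA k : A ^+ k = invmx U * diag_mx d ^+ k * U.
  elim: k => [|k IHk]; first by rewrite !expr0 mulr1 -mulmxE mulVmx.
  rewrite exprS IHk [A in A * _]defA exprS -!mulmxE !mulmxA.
  by rewrite mulmxK.
exists (fun i => complex.Re (d 0 i)); split=> [k|i].
  apply: (fmorph_inj f); rewrite -trace_map_mx map_mx_exp -/A powA.
  rewrite mxtrace_mulrC -mulmxE mulmxA mulmxV // mul1mx diag_mx_exp mxtrace_diag.
  rewrite rmorph_sum; apply: eq_bigr => i _.
  by rewrite mxE rmorphXn /= -/f -d_real.
(* The rows of [U] are complex eigenvectors; a real one exists because the eigenvalue is a root of
   the characteristic polynomial, which has coefficients in [R]. *)
have /eigenvalueP[v vS vN0] : eigenvalue S (complex.Re (d 0 i)).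
  rewrite eigenvalue_root_char -(fmorph_root f) map_char_poly -eigenvalue_root_char.
  apply/eigenvalueP; exists (row i U); last first.
    apply: contraL uU => /eqP rU0; rewrite -row_free_unit.
    apply/negP => /row_freeP[B UB]; have := congr1 (row i) UB.
    rewrite row_mul rU0 mul0mx => /rowP/(_ i); rewrite !mxE eqxx.
    by move/esym/eqP; rewrite oner_eq0.
  rewrite -/A -row_mul [X in U *m X]defA !mulmxA mulmxV // mul1mx.
  by apply/rowP => j; rewrite mul_diag_mx !mxE [in LHS]d_real.
by exists v.
Qed.

(** * Trace inequalities for symmetric nonnegative matrices *)

Section TraceForm.
Variables (R : realDomainType) (n : nat).
Implicit Types (A B D S X : 'M[R]_n) (c th : R).

Lemma mxtrace_trmx_mulE A X :
  \tr (X^T * A * X) = \sum_k \sum_i \sum_j A i j * X i k * X j k.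
Proof.
apply: eq_bigr => k _; rewrite -!mulmxE mxE exchange_big /=.
apply: eq_bigr => j _; rewrite mxE mulr_suml; apply: eq_bigr => i _.
by rewrite mxE [X i k * _]mulrC.
Qed.

(** Replace [x i * x j] by [(x i ^+ 2 + x j ^+ 2) / 2]; by symmetry of [A] both squares give the
    same sum, which the row sums bound. *)
Lemma schur_form A c (x : 'I_n -> R) : A^T = A -> (forall i j, 0 <= A i j) ->
  (forall i, \sum_j A i j <= c) ->
  \sum_i \sum_j A i j * x i * x j <= c * \sum_i x i ^+ 2.
Proof.
move=> symA A0 rowA; have symE i j : A i j = A j i by rewrite -[in LHS]symA mxE.
have : \sum_i \sum_j A i j * x i ^+ 2 <= c * \sum_i x i ^+ 2.
  rewrite mulr_sumr; apply: ler_sum => i _.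
  by rewrite -mulr_suml ler_wpM2r ?sqr_ge0.
suff : 2 * \sum_i \sum_j A i j * x i * x j <=
    2 * \sum_i \sum_j A i j * x i ^+ 2 by lra.
have -> : 2 * \sum_i \sum_j A i j * x i ^+ 2 =
    \sum_i \sum_j A i j * (x i ^+ 2 + x j ^+ 2).
  under [RHS]eq_bigr => i _ do (under eq_bigr => j _ do rewrite mulrDr; rewrite big_split).
  rewrite big_split /= [X in _ = _ + X]exchange_big /=.
  under [X in _ = _ + X]eq_bigr => i _ do under eq_bigr => j _ do rewrite symE.
  by rewrite mulr_natl mulr2n.
rewrite mulr_sumr; apply: ler_sum => i _; rewrite mulr_sumr; apply: ler_sum => j _.
rewrite -mulrA mulrCA; apply: ler_wpM2l => //.
by have := sqr_ge0 (x i - x j); nra.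
Qed.

Lemma schur_test A c X : A^T = A -> (forall i j, 0 <= A i j) ->
  (forall i, \sum_j A i j <= c) -> \tr (X^T * A * X) <= c * \tr (X^T * X).
Proof.
move=> symA A0 rowA; rewrite -[X in _ * \tr (X * _)]mulr1 !mxtrace_trmx_mulE mulr_sumr.
apply: ler_sum => k _; apply: le_trans (schur_form (X^~ k) symA A0 rowA) _.
rewrite le_eqVlt; apply/orP; left; apply/eqP; congr (_ * _).
apply: eq_bigr => i _; rewrite (bigD1 i) //= big1 ?addr0; last first.
  by move=> j nij; rewrite mxE eq_sym (negPf nij) !mul0r.
by rewrite mxE eqxx mul1r expr2.
Qed.

Section Contraction.
Variable S : 'M[R]_n.
Hypotheses (symS : S^T = S) (S0 : forall i j, 0 <= S i j)
  (rowS : forall i, \sum_j S i j <= 1).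

Lemma trmx_expr_sym k : (S ^+ k)^T = S ^+ k.
Proof.
elim: k => [|k IHk]; first by rewrite expr0 trmx1.
by rewrite [in LHS]exprS -mulmxE trmx_mul IHk symS mulmxE exprSr.
Qed.

Lemma expr_mx_ge0 k i j : 0 <= (S ^+ k) i j.
Proof.
elim: k i j => [|k IHk] i j; first by rewrite expr0 mxE ler0n.
by rewrite exprS -mulmxE mxE; apply: sumr_ge0 => x _; rewrite mulr_ge0.
Qed.

Lemma expr_mx_row_le1 k i : \sum_j (S ^+ k) i j <= 1.
Proof.
elim: k i => [|k IHk] i.
  rewrite expr0 (bigD1 i) //= big1 ?addr0 ?mxE ?eqxx //.
  by move=> j nij; rewrite mxE eq_sym (negPf nij).
under eq_bigr => j _ do rewrite exprS -mulmxE mxE.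
rewrite exchange_big /=; under eq_bigr => x _ do rewrite -mulr_sumr.
apply: le_trans (rowS i); apply: ler_sum => x _.
by rewrite -[leRHS]mulr1 ler_wpM2l.
Qed.

(** Powers of [S] inherit its three properties, so the Schur test applies with constant 1. *)
Lemma mxtrace_form_expr_le k X : \tr (X^T * S ^+ k * X) <= \tr (X^T * X).
Proof.
rewrite -[leRHS]mul1r; apply: schur_test => [|i j|i].
- exact: trmx_expr_sym.
- exact: expr_mx_ge0.
- exact: expr_mx_row_le1.
Qed.

Lemma mxtrace_expr_even_decr a b : (a <= b)%N ->
  \tr (S ^+ (2 * b)) <= \tr (S ^+ (2 * a)).
Proof.
move=> le_ab; rewrite -(subnKC le_ab); move: (b - a)%N => m.
have -> : \tr (S ^+ (2 * (a + m))) = \tr ((S ^+ a)^T * S ^+ (2 * m) * S ^+ a).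
  by rewrite trmx_expr_sym -!exprD; congr (\tr (_ ^+ _)); lia.
have -> : \tr (S ^+ (2 * a)) = \tr ((S ^+ a)^T * S ^+ a).
  by rewrite trmx_expr_sym -!exprD; congr (\tr (_ ^+ _)); lia.
exact: mxtrace_form_expr_le.
Qed.

(* [D] stands for the coordinate projection onto the rungs through a vertex:
   a walk step into those rungs gains the factor [th]. *)
Section Conflict.
Variables (D : 'M[R]_n) (th : R).
Hypotheses (symD : D^T = D) (idemD : D * D = D) (th0 : 0 <= th)
  (DSSD : forall X, \tr (X^T * (D * S ^+ 2 * D) * X) <= th * \tr (X^T * D * X)).

(** Split [S ^+ b] as [S * S ^+ (b - 2) * S] and bound the middle power by the identity; what
    remains is [D * S ^+ 2 * D], which gains the factor [th]. *)
Lemma mxtrace_conflict_even a b : (2 <= b)%N ->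
  \tr (S ^+ (2 * a) * (D * S ^+ b * D)) <= th * \tr (S ^+ (2 * a) * D).
Proof.
move=> b2; have cyc A : \tr (S ^+ (2 * a) * A) = \tr (S ^+ a * A * S ^+ a).
  by rewrite [RHS]mxtrace_mulrC mulrA -exprD addnn -mul2n.
rewrite !cyc; have := DSSD (S ^+ a); rewrite !trmx_expr_sym; apply: le_trans.
have -> : \tr (S ^+ a * (D * S ^+ 2 * D) * S ^+ a) =
    \tr ((S * D * S ^+ a)^T * (S * D * S ^+ a)).
  rewrite -!mulmxE !trmx_mul trmx_expr_sym symD symS !mulmxE.
  by rewrite !mulrA.
have -> : \tr (S ^+ a * (D * S ^+ b * D) * S ^+ a) =
    \tr ((S * D * S ^+ a)^T * S ^+ (b - 2) * (S * D * S ^+ a)).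
  rewrite -!mulmxE !trmx_mul trmx_expr_sym symD symS !mulmxE.
  have -> : S ^+ b = S * S ^+ (b - 2) * S.
    by rewrite -exprS -exprSr; congr (_ ^+ _); lia.
  by rewrite !mulrA.
exact: mxtrace_form_expr_le.
Qed.

Lemma mxtrace_expr_proj_decr a b : (a <= b)%N ->
  \tr (S ^+ (2 * b) * D) <= \tr (S ^+ (2 * a) * D).
Proof.
move=> le_ab; rewrite -(subnKC le_ab); move: (b - a)%N => m.
have cyc k : \tr (S ^+ (2 * a + k) * D) = \tr ((S ^+ a * D)^T * S ^+ k * (S ^+ a * D)).
  rewrite -[in LHS]idemD -!mulmxE trmx_mul trmx_expr_sym symD !mulmxE.
  have -> : (2 * a + k = a + k + a)%N by lia.
  by rewrite mulrA mxtrace_mulrC !exprD !mulrA.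
rewrite mulnDr cyc -[(2 * a)%N]addn0 cyc expr0 mulr1.
exact: mxtrace_form_expr_le.
Qed.

(* For a coincidence cutting a closed walk into an odd arc and an even arc: when
   the even arc is short, the odd one is first shortened by one step. *)
Lemma mxtrace_conflict_odd g p o : (1 <= p)%N -> (2 <= o)%N ->
  (o + 2 * p = 4 * g + 1)%N ->
  \tr (S ^+ o * (D * S ^+ (2 * p) * D)) <= th * \tr (S ^+ (2 * g) * D).
Proof.
move=> p1 o2 eq_op; have [le_gp|lt_pg] := leqP g p.
  apply: le_trans (ler_wpM2l th0 (mxtrace_expr_proj_decr le_gp)).
  rewrite mulrA mxtrace_mulrC !mulrA mxtrace_mulrC.
  by have := mxtrace_conflict_even p o2; rewrite !mulrA.
(* Here [o = 2 * q + 1]: dropping the middle step of the odd arc leaves two even arcs, of lengths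
   [2 * q] and [2 * p]. *)
set q := (2 * g - p)%N; have le_gq : (g <= q)%N by rewrite /q; lia.
apply: le_trans (ler_wpM2l th0 (mxtrace_expr_proj_decr le_gq)).
apply: le_trans (mxtrace_conflict_even q (b := 2 * p) _); last by lia.
pose Z := S ^+ p * D * S ^+ q.
have Ztr : Z^T = S ^+ q * D * S ^+ p.
  by rewrite /Z -!mulmxE !trmx_mul !trmx_expr_sym symD !mulmxE mulrA.
have -> : S ^+ (2 * p) = S ^+ p * S ^+ p by rewrite -exprD; congr (_ ^+ _); lia.
have -> : S ^+ (2 * q) = S ^+ q * S ^+ q by rewrite -exprD; congr (_ ^+ _); lia.
have -> : S ^+ o = S ^+ q * S ^+ 1 * S ^+ q.
  by rewrite -!exprD; congr (_ ^+ _); rewrite /q; lia.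
have cyc B : \tr (B * (D * (S ^+ p * S ^+ p) * D)) =
    \tr (S ^+ p * D * B * D * S ^+ p).
  by rewrite mxtrace_mulrC [RHS]mxtrace_mulrC !mulrA [RHS]mxtrace_mulrC !mulrA.
by have := mxtrace_form_expr_le 1 Z^T; rewrite trmxK Ztr /Z !cyc !mulrA.
Qed.

(** The total length is odd, so exactly one arc is even, and cyclicity of the trace puts it in the
    required place. *)
Lemma mxtrace_conflict g a b : (2 <= a)%N -> (2 <= b)%N ->
  (a + b = 4 * g + 1)%N ->
  \tr (D * S ^+ a * D * S ^+ b) <= th * \tr (S ^+ (2 * g) * D).
Proof.
move=> a2 b2 eq_ab; rewrite mxtrace_mulrC; case: (boolP (odd b)) => [ob|eb].
  have [p def_a] : exists p, a = (2 * p)%N by exists a./2; lia.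
  rewrite def_a !mulrA.
  by have := @mxtrace_conflict_odd g p b; rewrite !mulrA; apply; lia.
have -> : \tr (S ^+ b * (D * S ^+ a * D)) = \tr (S ^+ a * (D * S ^+ b * D)).
  by rewrite mulrA mxtrace_mulrC !mulrA mxtrace_mulrC !mulrA.
have [p def_b] : exists p, b = (2 * p)%N by exists b./2; lia.
by rewrite def_b; apply: mxtrace_conflict_odd; lia.
Qed.
End Conflict.
End Contraction.
End TraceForm.

(** * Entries of matrix products as sums over walks *)

Fixpoint seqsum (V : nmodType) (I : finType) k (phi : seq I -> V) : V :=
  if k is k'.+1 then \sum_x seqsum k' (fun s => phi (x :: s)) else phi [::].

Lemma eq_seqsum (V : nmodType) (I : finType) k (phi psi : seq I -> V) :
  (forall s, phi s = psi s) -> seqsum k phi = seqsum k psi.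
Proof.
elim: k phi psi => [|k IHk] phi psi eq_phi //=.
by apply: eq_bigr => x _; apply: IHk => s.
Qed.

Lemma ltr_sum_ex (R : realDomainType) (I : finType) (F G : I -> R) :
  \sum_x F x < \sum_x G x -> exists x, F x < G x.
Proof.
move=> ltFG; apply/existsP; apply: contraLR ltFG => /existsPn leGF.
by rewrite -leNgt; apply: ler_sum => x _; rewrite leNgt leGF.
Qed.

Lemma ltr_seqsum_ex (R : realDomainType) (I : finType) k (phi psi : seq I -> R) :
  seqsum k phi < seqsum k psi -> exists2 s, size s = k & phi s < psi s.
Proof.
elim: k phi psi => [|k IHk] phi psi /=; first by exists [::].
by case/ltr_sum_ex => x /IHk[s sz_s lt_s]; exists (x :: s); rewrite /= ?sz_s.
Qed.

Lemma seqsum_sum (V : nmodType) (I J : finType) (P : pred J) k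
    (phi : J -> seq I -> V) :
  seqsum k (fun s => \sum_(j | P j) phi j s) = \sum_(j | P j) seqsum k (phi j).
Proof.
elim: k phi => [|k IHk] phi //=.
by rewrite exchange_big; apply: eq_bigr => x _; rewrite IHk.
Qed.

Lemma seqsum_mulr (R : pzRingType) (I : finType) k (c : R) (phi : seq I -> R) :
  seqsum k (fun s => c * phi s) = c * seqsum k phi.
Proof.
elim: k phi => [|k IHk] phi //=.
by rewrite mulr_sumr; apply: eq_bigr => x _; rewrite IHk.
Qed.

(** The walk visits [i :: s], step [k] going from entry [k] of [i :: s] to entry [k] of [s]; the
    last factor makes it end at [j]. The default [x0] is never read, since [s] has length [l]. *)
Lemma prod_mx_walks (R : comNzRingType) n l (A : nat -> 'M[R]_n) (x0 i j : 'I_n) :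
  (\prod_(k < l) A k) i j =
  seqsum l (fun s => (\prod_(k < l) A k (nth x0 (i :: s) k) (nth x0 s k)) *
                     (last i s == j)%:R).
Proof.
elim: l A i => [|l IHl] A i /=; first by rewrite !big_ord0 mxE mul1r.
rewrite big_ord_recl -mulmxE mxE; apply: eq_bigr => x _.
rewrite (IHl (fun k => A k.+1)) -seqsum_mulr; apply: eq_seqsum => s.
by rewrite big_ord_recl /= mulrA.
Qed.

(** * Closed walks that meet a vertex twice *)

Section Conflicts.
Variables (R : realDomainType) (n : nat) (V : finType) (inc : V -> pred 'I_n).
Variables (S : 'M[R]_n) (th : R).
Hypotheses (symS : S^T = S) (S0 : forall i j, 0 <= S i j)
  (rowS : forall i, \sum_j S i j <= 1).
Hypothesis inc2 : forall i, (#|[pred v | inc v i]| <= 2)%N.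
Hypothesis inc_disj : forall i j v, S i j != 0 -> inc v i -> ~~ inc v j.
Hypothesis inc_th : forall v i, \sum_(j | inc v j) S i j <= th.
Hypothesis th0 : 0 <= th.

Definition inc_mx v : 'M[R]_n := diag_mx (\row_i (inc v i)%:R).

Lemma inc_mx_mull v (A : 'M[R]_n) i j : (inc_mx v * A) i j = (inc v i)%:R * A i j.
Proof. by rewrite -mulmxE mul_diag_mx !mxE. Qed.

Lemma inc_mx_mulr v (A : 'M[R]_n) i j : (A * inc_mx v) i j = A i j * (inc v j)%:R.
Proof. by rewrite -mulmxE mul_mx_diag !mxE. Qed.

Lemma inc_mx_sym v : (inc_mx v)^T = inc_mx v.
Proof. exact: tr_diag_mx. Qed.

Lemma inc_mx_idem v : inc_mx v * inc_mx v = inc_mx v.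
Proof.
apply/matrixP => i j; rewrite inc_mx_mull !mxE.
by case: (inc v i) => /=; rewrite ?mul0r ?mul1r ?mul0rn.
Qed.

Lemma inc_mx_step v : inc_mx v * S * inc_mx v = 0.
Proof.
apply/matrixP => i j; rewrite inc_mx_mulr inc_mx_mull mxE.
have [->|Sij] := eqVneq (S i j) 0; first by rewrite mulr0 mul0r.
have := inc_disj Sij (v := v); case: (inc v i) => [/(_ isT)/negPf-> | _].
  by rewrite mulr0.
by rewrite !mul0r.
Qed.

(** One step of [S] has mass at most 1 and the next lands on [v] with mass at most [th], so the rows
    of [D * S ^+ 2 * D] sum to at most [th]; the Schur test is then applied to [D * X]. *)
Lemma inc_mx_form v X : \tr (X^T * (inc_mx v * S ^+ 2 * inc_mx v) * X) <=
  th * \tr (X^T * inc_mx v * X).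
Proof.
set D := inc_mx v; pose Y := D * X; have idemD : D * D = D := inc_mx_idem v.
have trY : Y^T = X^T * D by rewrite /Y -!mulmxE trmx_mul inc_mx_sym.
have -> : X^T * (D * S ^+ 2 * D) * X = Y^T * (D * S ^+ 2 * D) * Y.
  rewrite trY /Y.
  have -> : X^T * D * (D * S ^+ 2 * D) * (D * X) = X^T * (D * D) * S ^+ 2 * (D * D) * X.
    by rewrite !mulrA.
  by rewrite idemD !mulrA.
have -> : X^T * D * X = Y^T * Y by rewrite trY /Y -[in LHS]idemD !mulrA.
apply: schur_test => [|i j|i].
- by rewrite -!mulmxE !trmx_mul inc_mx_sym symS !mulmxE -!mulrA.
- by rewrite inc_mx_mulr inc_mx_mull !mulr_ge0 ?ler0n ?expr_mx_ge0.
under eq_bigr => j _ do rewrite inc_mx_mulr inc_mx_mull -mulrA.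
rewrite -mulr_sumr; case: (inc v i); last by rewrite mul0r.
rewrite mul1r; under eq_bigr => j _ do rewrite mulr_natr mulrb.
rewrite -big_mkcond /=; under eq_bigr => j _ do rewrite expr2 -mulmxE mxE.
rewrite exchange_big /=; under eq_bigr => x _ do rewrite -mulr_sumr.
rewrite -[leRHS]mul1r; apply: le_trans (ler_wpM2r th0 (rowS i)).
by rewrite mulr_suml; apply: ler_sum => x _; rewrite ler_wpM2l.
Qed.

(** The projections restrict the trace to closed walks through [v] at times [p] and [q]; rotated to
    start at [p], such a walk splits into arcs of lengths [q - p] and [4 * g + 1 - (q - p)]. *)
Lemma mxtrace_coincidence g v (p q : nat) : (p < q)%N -> (q < 4 * g + 1)%N ->
  \tr (\prod_(k < 4 * g + 1) (if (k == p :> nat) || (k == q :> nat)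
                             then inc_mx v * S else S)) <=
  th * \tr (S ^+ (2 * g) * inc_mx v).
Proof.
move=> lt_pq lt_ql; set D := inc_mx v.
pose A k := if (k == p) || (k == q) then D * S else S.
have constA a b : (forall k, (a <= k < b)%N -> k != p /\ k != q) ->
    \prod_(a <= k < b) A k = S ^+ (b - a).
  move=> ab; rewrite -prodr_const_nat; apply: eq_big_nat => k /ab[kp kq].
  by rewrite /A (negPf kp) (negPf kq).
have -> : \prod_(k < 4 * g + 1) A k =
    S ^+ p * (D * S * S ^+ (q - p.+1)) * (D * S * S ^+ (4 * g + 1 - q.+1)).
  rewrite -(big_mkord xpredT A) (big_cat_nat (n := q)) //=; last exact: ltnW.
  rewrite (big_cat_nat (n := p)) //=; last exact: ltnW.
  rewrite [\prod_(p <= _ < _) _]big_ltn // [\prod_(q <= _ < _) _]big_ltn //.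
  rewrite !constA; try by move=> k hk; split; lia.
  by rewrite /A !eqxx orbT subn0.
have -> : \tr (S ^+ p * (D * S * S ^+ (q - p.+1)) * (D * S * S ^+ (4 * g + 1 - q.+1))) =
    \tr (D * S ^+ (q - p) * D * S ^+ (4 * g + 1 - (q - p))).
  rewrite -mulrA mxtrace_mulrC !mulrA.
  have -> : S ^+ (q - p) = S * S ^+ (q - p.+1) by rewrite -exprS; congr (_ ^+ _); lia.
  have -> : S ^+ (4 * g + 1 - (q - p)) = S * S ^+ (4 * g + 1 - q.+1) * S ^+ p.
    by rewrite -exprS -exprD; congr (_ ^+ _); lia.
  by rewrite !mulrA.
have rhs0 : 0 <= th * \tr (S ^+ (2 * g) * D).
  apply: mulr_ge0 => //; apply: sumr_ge0 => i _.
  by rewrite inc_mx_mulr mulr_ge0 ?ler0n ?expr_mx_ge0.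
(* An arc of length 1 would join two rungs through [v], so its term vanishes; otherwise both arcs
   have length at least 2. *)
have [a1|a1] := eqVneq (q - p)%N 1%N.
  by rewrite a1 expr1 inc_mx_step mul0r mxtrace0.
have [b1|b1] := eqVneq (4 * g + 1 - (q - p))%N 1%N.
  by rewrite b1 expr1 -mulrA mxtrace_mulrC !mulrA inc_mx_step mul0r mxtrace0.
apply: mxtrace_conflict => //; try lia; first exact: inc_mx_sym.
  exact: inc_mx_idem.
exact: inc_mx_form.
Qed.

Lemma sum_inc_mx k :
  \sum_v \tr (S ^+ k * inc_mx v) <= 2 * \tr (S ^+ k).
Proof.
rewrite mulr_sumr exchange_big /=; apply: ler_sum => i _.
under eq_bigr => v _ do rewrite inc_mx_mulr.
rewrite -mulr_sumr mulrC ler_wpM2r ?expr_mx_ge0 //.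
rewrite -natr_sum ler_nat; apply: leq_trans (inc2 i).
rewrite -sum1_card [leqRHS]big_mkcond; apply: leq_sum => v _.
by rewrite inE; case: (inc v i).
Qed.

(** A union bound over pairs of positions and over vertices; the factor 2 is the number of vertices
    on a rung. *)
Lemma disjoint_closed_walk g :
  2 * (4 * g + 1)%:R ^+ 2 * th * \tr (S ^+ (2 * g)) < \tr (S ^+ (4 * g + 1)) ->
  exists w : nat -> 'I_n,
    (forall i, (i < 4 * g + 1)%N -> S (w i) (w (i.+1 %% (4 * g + 1))%N) != 0) /\
    (forall v i j, (i < j < 4 * g + 1)%N -> inc v (w i) -> ~~ inc v (w j)).
Proof.
set l := (4 * g + 1)%N => big_tr.

have l0 : (0 < l)%N by rewrite /l addn1.
have n_gt0 : (0 < n)%N.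
  rewrite lt0n; apply: contraTneq big_tr => n0; rewrite -leNgt /mxtrace.
  have noI (i : 'I_n) : False by case: i => i; rewrite n0.
  by rewrite !big1 ?mulr0 // => i; case: (noI i).
pose x0 := Ordinal n_gt0; pose wk i s k := nth x0 (i :: s) k.
pose wt i s := (\prod_(k < l) S (wk i s k) (nth x0 s k)) * (last i s == i)%:R.
pose coin i s p q v : R := ((p < q)%N && (inc v (wk i s p) && inc v (wk i s q)))%:R.
have wt0 i s : 0 <= wt i s by rewrite mulr_ge0 ?ler0n // prodr_ge0.
have trE : \tr (S ^+ l) = \sum_i seqsum l (wt i).
  apply: eq_bigr => i _; have -> : S ^+ l = \prod_(k < l) S by rewrite prodr_const card_ord.
  by rewrite (prod_mx_walks _ (fun=> S) x0).
have coinE (p q : 'I_l) v : \sum_i seqsum l (fun s => wt i s * coin i s p q v) <=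
    th * \tr (S ^+ (2 * g) * inc_mx v).
  have [lt_pq|le_qp] := ltnP p q; last first.
    rewrite big1 => [|i _].
      rewrite mulr_ge0 //; apply: sumr_ge0 => i _.
      by rewrite inc_mx_mulr mulr_ge0 ?ler0n ?expr_mx_ge0.
    rewrite (@eq_seqsum _ _ _ _ (fun s => 0 * 0)) ?seqsum_mulr ?mul0r // => s.
    by rewrite /coin ltnNge le_qp !mulr0.
  have := @mxtrace_coincidence g v p q lt_pq (ltn_ord q); apply: le_trans.
  rewrite le_eqVlt; apply/orP; left; apply/eqP/eq_bigr => i _.
  rewrite (prod_mx_walks _ (fun k => if (k == p :> nat) || (k == q :> nat)
                                   then inc_mx v * S else S) x0).
  apply: eq_seqsum => s; rewrite /wt mulrAC; congr (_ * _).
  have -> : coin i s p q v = \prod_(k < l)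
      (if (k == p) || (k == q) then (inc v (wk i s k))%:R else 1).
    rewrite (bigD1 p) // (bigD1 q) /=; last by rewrite neq_ltn lt_pq orbT.
    rewrite eqxx eqxx orbT big1 ?mulr1 /coin ?lt_pq ?mulnb ?natrM //=.
      by rewrite -natrM mulnb.
    by move=> k /andP[/negPf-> /negPf->].
  rewrite -big_split; apply: eq_bigr => k _ /=; rewrite -!val_eqE /= -/(wk i s k).
  by case: ifP => _; rewrite ?mulr1 // inc_mx_mull mulrC.
(* On the left each closed walk is counted once per coincidence. A walk contributing more to the
   right than to the left has positive weight and no coincidence. *)
have : \sum_i seqsum l (fun s => \sum_(pq : 'I_l * 'I_l)
    \sum_v wt i s * coin i s pq.1 pq.2 v) < \sum_i seqsum l (wt i).
  rewrite -trE; apply: le_lt_trans big_tr.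
  under eq_bigr => i _.
    rewrite seqsum_sum; under eq_bigr => pq _ do rewrite seqsum_sum.
    over.
  rewrite exchange_big /=; under eq_bigr => pq _ do rewrite exchange_big /=.
  apply: (@le_trans _ _ (\sum_(pq : 'I_l * 'I_l) th * (2 * \tr (S ^+ (2 * g))))).
    apply: ler_sum => pq _; apply: le_trans (ler_wpM2l th0 (sum_inc_mx _)).
    by rewrite mulr_sumr; apply: ler_sum => v _; apply: coinE.
  rewrite sumr_const card_prod card_ord -[leLHS]mulr_natl natrM.
  by rewrite le_eqVlt; apply/orP; left; apply/eqP; ring.
case/ltr_sum_ex => i /ltr_seqsum_ex[s sz_s lt_s].
have wt_gt0 : 0 < wt i s.
  apply: le_lt_trans lt_s; do 2![apply: sumr_ge0 => ? _].
  by rewrite mulr_ge0 ?ler0n.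
have coin0 v (p q : 'I_l) : coin i s p q v = 0.
  apply/eqP; apply: contraTT lt_s => coin_neq0; rewrite -leNgt.
  have wt_coin0 a b u : 0 <= wt i s * coin i s a b u by rewrite mulr_ge0 ?ler0n.
  rewrite (bigD1 (p, q)) //=; apply: ler_wpDr.
    by do 2![apply: sumr_ge0 => ? _].
  rewrite (bigD1 v) //=; apply: ler_wpDr; first by apply: sumr_ge0 => ? _.
  by move: coin_neq0; rewrite /coin; case: (_ && _); rewrite ?mulr1 // eqxx.
have lastE : last i s = i.
  by apply: contraTeq wt_gt0 => /negPf h; rewrite /wt h mulr0 ltxx.
exists (wk i s); split=> [k lt_kl|v p q /andP[lt_pq lt_ql] inc_p].
  (* For [k = l - 1] the index wraps to 0, and [last i s = i] closes the walk. *)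
  have -> : wk i s (k.+1 %% l)%N = nth x0 s k.
    rewrite /wk; case: (ltngtP k.+1 l) => [h|h|h]; last 1 first.
    - by rewrite h modnn /= -lastE -nth_last sz_s -h /= (set_nth_default x0) ?sz_s // -h.
    - by rewrite modn_small.
    - by move: h; rewrite ltnS leqNgt lt_kl.
  apply: contraTneq wt_gt0 => Sk0; rewrite /wt.
  by rewrite (bigD1 (Ordinal lt_kl)) //= Sk0 !mul0r ltxx.
have := coin0 v (Ordinal (ltn_trans lt_pq lt_ql)) (Ordinal lt_ql).
rewrite /coin /= lt_pq inc_p /=; case: (inc v _) => //= /eqP.
by rewrite oner_eq0.
Qed.
End Conflicts.

(** * Lower bounds for even and odd traces *)

Lemma mxtrace_expr_ge (R : realFieldType) n (S : 'M[R]_n) (F : {set 'I_n}) rho g :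
  S^T = S -> (forall i j, 0 <= S i j) -> 0 <= rho -> F != set0 ->
  (forall i, i \in F -> rho <= \sum_j S i j) ->
  (forall i j, S i j != 0 -> j \in F) ->
  rho ^+ (2 * g) <= \tr (S ^+ (2 * g)).
Proof.
move=> symS S0 rho0 F0 rowF suppF.
have rowX k i : i \in F -> rho ^+ k <= \sum_(j in F) (S ^+ k) i j.
  elim: k i => [|k IHk] i iF.
    rewrite expr0 (bigD1 i) //= expr0 mxE eqxx lerDl; apply: sumr_ge0 => j _.
    by rewrite mxE ler0n.
  under eq_bigr => j _ do rewrite exprS -mulmxE mxE.
  rewrite exchange_big /= exprSr.
  apply: le_trans (ler_wpM2l (exprn_ge0 k rho0) (rowF i iF)) _.
  rewrite mulr_sumr; apply: ler_sum => x _; rewrite -mulr_sumr mulrC.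
  have [->|Six] := eqVneq (S i x) 0; first by rewrite !mul0r.
  by rewrite ler_wpM2l // IHk // (suppF _ _ Six).
have F_gt0 : 0 < #|F|%:R :> R by rewrite ltr0n card_gt0.
(* The even trace is a sum of squares; in [S ^+ g], each row indexed by [F] has sum at least
   [rho ^+ g] over the columns in [F]. *)
have -> : \tr (S ^+ (2 * g)) = \sum_i \sum_j (S ^+ g) i j ^+ 2.
  apply: eq_bigr => i _; rewrite mul2n -addnn exprD -mulmxE mxE.
  by apply: eq_bigr => j _; rewrite expr2 -[in X in _ * X](trmx_expr_sym symS) mxE.
pose t := rho ^+ g / #|F|%:R.
have t0 : 0 <= t by rewrite divr_ge0 ?exprn_ge0 // ltW.
apply: (@le_trans _ _ (\sum_(i in F) rho ^+ (2 * g) / #|F|%:R)).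
  by rewrite sumr_const -[_ *+ #|F|]mulr_natr mulfVK ?gt_eqF.
have sq0 i j : 0 <= (S ^+ g) i j ^+ 2 := sqr_ge0 _.
rewrite [leRHS](bigID (mem F)) /=; apply: ler_wpDr.
  by do 2![apply: sumr_ge0 => ? _].
apply: ler_sum => i iF; rewrite [leRHS](bigID (mem F)) /=; apply: ler_wpDr.
  by apply: sumr_ge0 => ? _.
(* Cauchy-Schwarz for one row, by the tangent line of the square at [t], the lower bound for the
   average entry. *)
apply: (@le_trans _ _ (\sum_(j in F) (2 * t * (S ^+ g) i j - t ^+ 2))); last first.
  by apply: ler_sum => j _; have := sqr_ge0 ((S ^+ g) i j - t); nra.
rewrite sumrB sumr_const -mulr_sumr -[t ^+ 2 *+ _]mulr_natr.
have := ler_wpM2l t0 (rowX g i iF).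
have -> : t ^+ 2 * #|F|%:R = t * rho ^+ g by rewrite /t expr2 -!mulrA mulVf ?gt_eqF // mulr1.
have -> : rho ^+ (2 * g) / #|F|%:R = t * rho ^+ g.
  by rewrite mul2n -addnn exprD /t mulrAC.
lra.
Qed.

(** All eigenvalues lie in [[- be, 1]]. For a nonnegative one the power [4 * g + 2] is at most the
    power [4 * g + 1]; for a negative one the two powers differ by at most
    [2 * be ^+ (4 * g + 1)]. *)
Lemma mxtrace_expr_odd_ge (R : rcfType) n (S : 'M[R]_n) be g :
  S^T = S -> (forall i j, 0 <= S i j) -> (forall i, \sum_j S i j <= 1) ->
  0 <= be <= 1 ->
  (forall x : 'I_n -> R, - be * \sum_i x i ^+ 2 <= \sum_i \sum_j S i j * x i * x j) ->
  \tr (S ^+ (4 * g + 2)) - 2 * n%:R * be ^+ (4 * g + 1) <= \tr (S ^+ (4 * g + 1)).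
Proof.
move=> symS S0 rowS /andP[be0 be1] formS.
have [lam [trE eig]] := symmetric_mx_eigen symS.
have lam_bound i : - be <= lam i <= 1.
  have [v vN0 vS] := eig i.
  have formE : \sum_i \sum_j S i j * v 0 i * v 0 j = lam i * \sum_j v 0 j ^+ 2.
    rewrite exchange_big mulr_sumr; apply: eq_bigr => j _ /=.
    have /rowP/(_ j) := vS; rewrite !mxE expr2 mulrA => <-; rewrite mulr_suml.
    by apply: eq_bigr => k _; rewrite [v 0 k * _]mulrC.
  have v_gt0 : 0 < \sum_j v 0 j ^+ 2.
    rewrite lt_neqAle sumr_ge0 ?andbT => [|j _]; last exact: sqr_ge0.
    apply: contra vN0; rewrite eq_sym psumr_eq0 => [/allP h|j _]; last exact: sqr_ge0.
    apply/eqP/rowP => j; rewrite mxE; apply/eqP; rewrite -sqrf_eq0.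
    by rewrite (implyP (h j _)) ?mem_index_enum.
  rewrite -(ler_pM2r v_gt0) -[lam i <= 1](ler_pM2r v_gt0) -formE formS.
  exact: schur_form.
have -> : 2 * n%:R * be ^+ (4 * g + 1) = \sum_(i < n) 2 * be ^+ (4 * g + 1).
  by rewrite sumr_const card_ord -[_ *+ n]mulr_natl; ring.
rewrite !trE -sumrB.
apply: ler_sum => i _; have /andP[lam_ge lam_le] := lam_bound i.
have pow_le (x : R) k : 0 <= x <= 1 -> x ^+ k.+1 <= x ^+ k.
  by case/andP=> x0 x1; rewrite exprSr ler_piMr // exprn_ge0.
rewrite addnS.
have [lam0|lam0] := leP 0 (lam i).
  by rewrite lerBlDr ler_wpDr ?mulr_ge0 ?exprn_ge0 // pow_le // lam0.
have odd_k : odd (4 * g + 1) by rewrite oddD oddM.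
pose m := - lam i; have -> : lam i = - m by rewrite opprK.
have m0 : 0 <= m <= be by rewrite /m; apply/andP; split; lra.
rewrite (exprNn m (4 * g + 1).+1) (exprNn m (4 * g + 1))
        -(signr_odd _ (4 * g + 1).+1) -(signr_odd _ (4 * g + 1)) [odd _.+1]/= odd_k /= expr0 expr1 mul1r mulN1r.
have /andP[m_ge m_le] := m0.
have := lerXn2r (4 * g + 1) m_ge be0 m_le.
have := @pow_le m (4 * g + 1)%N; rewrite m_ge (le_trans m_le be1) => /(_ isT).
move: (m ^+ _) (m ^+ _) (be ^+ _) => a b c; lra.
Qed.

(** * Choice of the walk length *)

Lemma slow_decay (R : realFieldType) (u : nat -> R) (K A B : R) J :
  0 < K -> (0 < J)%N -> u 0%N <= A -> B <= u J -> A <= K ^+ J * B ->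
  exists2 j, (j < J)%N & u j <= K * u j.+1.
Proof.
move=> K0 J0 uA uB AB; pose good (j : 'I_J) := u j <= K * u j.+1.
case: (pickP good) => [j le_j|bad]; first by exists j.
(* Otherwise each of the [J] steps shrinks [u] by more than the factor [K], which takes [u J] below
   [B]. *)
suff decay j : (j < J)%N -> K ^+ j.+1 * u j.+1 < u 0%N.
  have := decay J.-1; rewrite prednK // leqnn => /(_ isT) lt_u.
  by have := ler_wpM2l (exprn_ge0 J (ltW K0)) uB; lra.
have step k : (k < J)%N -> K * u k.+1 < u k.
  by move=> ltk; have := bad (Ordinal ltk); rewrite /good /= leNgt => /negbFE.
elim: j => [|j IHj] ltj; first by rewrite expr1; apply: step.
apply: le_lt_trans (IHj (ltnW ltj)).
by rewrite exprSr -mulrA ler_wpM2l ?exprn_ge0 ?ltW // step.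
Qed.

Lemma bernoulli (R : realDomainType) (x : R) k :
  0 <= x <= 1 -> 1 - k%:R * x <= (1 - x) ^+ k.
Proof.
case/andP=> x0 x1; elim: k => [|k IHk]; first by rewrite expr0 mul0r subr0.
rewrite exprS; apply: le_trans (ler_wpM2l _ IHk); last by rewrite subr_ge0.
rewrite -natr1; have : 0 <= k%:R * (x * x) by rewrite !mulr_ge0 ?ler0n.
by lra.
Qed.

(* The walks have length [4 * half_len P j + 1]: the traces of the powers
   [2 * half_len P j] are compared for consecutive [j]. *)
Definition half_len (P j : nat) := (2 ^ j * (P + 3) - 1)%N.

(** This recurrence dictates the form of [half_len]: the odd trace at [4 * g + 1] is compared with
    the even trace at [4 * g + 2], which is the next one in the list. *)
Lemma half_lenS P j : (4 * half_len P j + 2 = 2 * half_len P j.+1)%N.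
Proof.
by rewrite /half_len expnS; have : (0 < 2 ^ j)%N by [rewrite expn_gt0]; nia.
Qed.

Lemma half_len_ge P j : (P + 2 <= half_len P j)%N.
Proof. by rewrite /half_len; have : (0 < 2 ^ j)%N by [rewrite expn_gt0]; nia. Qed.

Lemma half_len_le P j J : (j < J)%N ->
  (4 * half_len P j + 1 <= 2 ^ (J + 2) * (P + 3))%N.
Proof.
move=> ltj; have : (2 ^ j.+1 <= 2 ^ J)%N by rewrite leq_exp2l.
by rewrite /half_len expnD expnS; nia.
Qed.

(** The even traces start at most at [2 ^+ P] and end at least at [2 ^- (P + 3)], so among [J]
    doublings one loses at most a factor [2 ^+ r]. At that length coincidences cannot use up the odd
    trace. *)
Lemma odd_disjoint_closed_walk (R : rcfType) n (V : finType)
    (inc : V -> pred 'I_n) (S : 'M[R]_n) (F : {set 'I_n}) (th : R) (P J r : nat) :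
  S^T = S -> (forall i j, 0 <= S i j) -> (forall i, \sum_j S i j <= 1) ->
  (forall i, (#|[pred v | inc v i]| <= 2)%N) ->
  (forall i j v, S i j != 0 -> inc v i -> ~~ inc v j) ->
  (forall v i, \sum_(j | inc v j) S i j <= th) -> 0 <= th ->
  F != set0 ->
  (forall i, i \in F -> 1 - 2 ^- (J + 3) <= \sum_j S i j) ->
  (forall i j, S i j != 0 -> j \in F) ->
  (forall x : 'I_n -> R,
    - (3 / 5) * \sum_i x i ^+ 2 <= \sum_i \sum_j S i j * x i * x j) ->
  (n <= 2 ^ P)%N -> (2 * P + 3 <= r * J)%N -> (0 < J)%N ->
  4 * (2 ^ (J + 2) * (P + 3))%:R ^+ 2 * th * 2 ^+ r < 1 ->
  exists l (w : nat -> 'I_n), [/\ odd l, (3 <= l)%N,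
    forall i, (i < l)%N -> S (w i) (w (i.+1 %% l)%N) != 0 &
    forall v i j, (i < j < l)%N -> inc v (w i) -> ~~ inc v (w j)].
Proof.
move=> symS S0 rowS inc2 disj inc_th th0 F0 rowF suppF formS nP PJ J0 small.
pose rho : R := 1 - 2 ^- (J + 3); pose be : R := 3 / 5.
have e_gt0 : 0 < 2 ^- (J + 3) :> R by rewrite invr_gt0 exprn_gt0.
have e_small : 2 ^- (J + 3) <= 1 / 16 :> R.
  rewrite div1r lef_pV2 ?posrE ?exprn_gt0 ?ltr0n //.
  rewrite -(prednK J0) addSnnS.
  rewrite exprD; have : 1 <= 2 ^+ J.-1 :> R by rewrite exprn_ege1 ?ler1n.
  have -> : 2 ^+ 4 = 16 :> R by rewrite -natrX.
  by lra.
have rho_bd : 15 / 16 <= rho <= 1 by rewrite /rho; apply/andP; split; lra.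
have /andP[rho_ge rho_le] := rho_bd.
have rho0 : 0 <= rho by lra.
pose g := half_len P.
have gS j : (4 * g j + 2 = 2 * g j.+1)%N := half_lenS P j.
pose u j := \tr (S ^+ (2 * g j)).
have u_ge j : rho ^+ (2 * g j) <= u j by apply: mxtrace_expr_ge rowF suppF.
have u_gt0 j : 0 < u j by apply: lt_le_trans (u_ge j); apply: exprn_gt0; lra.
have u0 : u 0%N <= 2 ^+ P.
  apply: (@le_trans _ _ n%:R); last by rewrite -natrX ler_nat.
  have := @mxtrace_expr_even_decr R n S symS S0 rowS 0 (g 0%N) isT.
  by rewrite expr0 mxtrace1.
(* By Bernoulli [rho ^+ (2 ^ J.+1)] is at least 3/4, hence at least 1/2; its power [P + 3] is what
   is needed. *)
have uJ : 2 ^- (P + 3) <= u J.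
  apply: le_trans (u_ge J); apply: (@le_trans _ _ (rho ^+ (2 ^ J.+1 * (P + 3)))); last first.
    by apply: ler_wiXn2l => //; rewrite /g /half_len expnS -mulnA leq_mul2l leq_subr.
  rewrite exprM -exprVn; apply: lerXn2r; rewrite ?nnegrE ?exprn_ge0 ?invr_ge0 //.
  apply: le_trans (bernoulli _ _); last by rewrite ltW //=; lra.
  rewrite natrX -(addSnnS J 2).
  rewrite exprD invfM mulrA mulfV ?gt_eqF ?exprn_gt0 // mul1r expr2; lra.
have [||j ltj u_slow] := @slow_decay R u (2 ^+ r) (2 ^+ P) (2 ^- (P + 3)) J _ J0 u0 uJ.
- by rewrite exprn_gt0.
- rewrite ler_pdivlMr ?exprn_gt0 // -exprD -exprM.
  by apply: ler_weXn2l; rewrite ?ler1n // addnA addnn -mul2n.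
pose l := (4 * g j + 1)%N.
have g_ge : (P + 2 <= g j)%N := half_len_ge P j.
have odd_l : odd l by rewrite oddD oddM.
have l_le : (l <= 2 ^ (J + 2) * (P + 3))%N := half_len_le P ltj.
have g_gt0 : (0 < g j)%N by apply: leq_trans g_ge; rewrite addn2.
have [|w [wS wd]] := @disjoint_closed_walk R n V inc S th symS S0 rowS inc2 disj inc_th th0 (g j).
  have tr_ge : \tr (S ^+ (4 * g j + 2)) - 2 * n%:R * be ^+ l <= \tr (S ^+ l).
    by apply: mxtrace_expr_odd_ge => //; rewrite /be; apply/andP; split; lra.
  (* The negative eigenvalues cost at most half of [u j.+1]: [be <= 2 / 3 * rho],
     [(2 / 3) ^+ 4 <= 1 / 4], and [g j >= P + 2] makes [(1 / 4) ^+ g j] beat [n]. *)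
  have be_small : 4 * n%:R * be ^+ l <= u j.+1.
    apply: le_trans (u_ge j.+1); rewrite -gS (_ : 4 * g j + 2 = l.+1)%N; last by rewrite /l addnS.
    apply: (@le_trans _ _ (4 * n%:R * ((2 / 3) ^+ l * rho ^+ l))).
      apply: ler_wpM2l; first by rewrite mulr_ge0.
      by rewrite -exprMn lerXn2r ?nnegrE ?mulr_ge0 //; rewrite /be; lra.
    rewrite exprS mulrA; apply: ler_wpM2r; first exact: exprn_ge0.
    apply: le_trans rho_ge; rewrite /l exprD exprM expr1.
    have : ((2 / 3) ^+ 4) ^+ g j <= (1 / 4) ^+ P * (1 / 16) :> R.
      apply: (@le_trans _ _ ((1 / 4) ^+ g j)).
        apply: lerXn2r; rewrite ?nnegrE ?exprn_ge0 //; lra.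
      apply: (@le_trans _ _ ((1 / 4) ^+ (P + 2))); first by apply: ler_wiXn2l => //; lra.
      by rewrite exprD; apply: ler_wpM2l; rewrite ?exprn_ge0 //; lra.
    have : n%:R * (1 / 4) ^+ P <= 1 :> R.
      apply: (@le_trans _ _ (2 ^+ P * (1 / 4) ^+ P)).
        by apply: ler_wpM2r; [apply: exprn_ge0; lra | rewrite -natrX ler_nat].
      by rewrite -exprMn exprn_ile1 //; lra.
    have : 0 <= n%:R :> R by [].
    move: (_ ^+ g j) (_ ^+ P) (n%:R) => a b c c0 cb ab.
    by have := ler_wpM2l c0 ab; lra.
  (* The odd trace is at least half of [u j.+1], while slow decay and [small] keep
     [2 * l ^ 2 * th * u j] below that half. *)
  rewrite gS in tr_ge; apply: lt_le_trans tr_ge.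
  have : l%:R ^+ 2 <= (2 ^ (J + 2) * (P + 3))%:R ^+ 2 :> R.
    by apply: lerXn2r; rewrite ?nnegrE ?ler0n // ler_nat.
  have : 0 <= l%:R ^+ 2 :> R by apply: sqr_ge0.
  move: (l%:R ^+ 2) (_%:R ^+ 2) small => L Q small L0 leLQ.
  have uS_gt0 := u_gt0 j.+1; have uj_gt0 := u_gt0 j.
  have K0 : 0 <= 2 ^+ r :> R by rewrite exprn_ge0.
  have : L * th * u j <= Q * th * (2 ^+ r * u j.+1).
    by apply: ler_pM; rewrite ?mulr_ge0 ?ler_wpM2r // ltW.
  have : 4 * Q * th * 2 ^+ r * u j.+1 < u j.+1 by rewrite gtr_pMl.
  rewrite -/(u j) -/(u j.+1) in be_small *.
  by lra.
exists l, w; split=> //.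
by rewrite /l addn1 ltnS (leq_trans _ (leq_pmulr 4 g_gt0)).
Qed.

(** * Odd ladders as cycles with all diagonals *)

Lemma odd_ladder_cdia (G : sgraph) l (a b : nat -> G) : odd l ->
  (forall i, (i < l)%N -> adj (a i) (b i)) ->
  (forall i, (i < l)%N -> adj (a i) (b (i.+1 %% l)%N)) ->
  (forall i, (i < l)%N -> adj (b i) (a (i.+1 %% l)%N)) ->
  (forall i j, (i < j < l)%N -> [&& a i != a j, a i != b j, b i != a j & b i != b j]) ->
  contains G (cdia l).
Proof.
move=> odd_l rung side_ab side_ba disj; have l0 : (0 < l)%N by case: l odd_l {rung side_ab side_ba disj}.
(* The cycle alternates between the two ends of successive rungs. As [l] is odd, one turn exchanges
   the ends: [x (k + l)] is the other end of the rung of [x k], and the cycle closes after [2 * l]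
   steps. *)
pose x k := if odd k then b (k %% l)%N else a (k %% l)%N.
have ltm k : (k %% l < l)%N by rewrite ltn_mod.
have neq_ab i : (i < l)%N -> a i != b i.
  by move=> /rung; apply: contraTneq => ->; rewrite adj_irrefl.
have xS k : adj (x k) (x (k.+1 %% (2 * l))%N).
  rewrite /x odd_mod ?oddM //= modn_dvdm ?dvdn_mull // -addn1 -modnDml addn1.
  by case: (odd k) => /=; [apply: side_ba | apply: side_ab].
have xD k : adj (x k) (x (k + l)%N).
  rewrite /x oddD odd_l addbT modnDr.
  by case: (odd k) => /=; [rewrite adj_sym; apply: rung | apply: rung].
exists (fun k : 'I_(2 * l) => x k); split=> [i j|i j]; last first.
  case/or4P => /eqP h; [rewrite h | rewrite h adj_sym | rewrite h | rewrite h adj_sym].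
  - exact: xS.
  - exact: xS.
  - exact: xD.
  - exact: xD.
have [lti ltj] := (ltn_ord i, ltn_ord j).
(* Two indices on the same rung with equal parity coincide: their quotients by the odd number [l]
   are 0 or 1 and have equal parity. *)
have [eq_m|neq_m] := eqVneq (i %% l)%N (j %% l)%N.
  have [eq_odd|neq_odd] := eqVneq (odd i) (odd j); last first.
    have := neq_ab _ (ltm j); rewrite /x eq_m => /eqP ne.
    by case: (odd i) (odd j) neq_odd => [] [] // _ /esym // /esym.
  move=> _.
  have := divn_eq i l; have := divn_eq j l; rewrite eq_m.
  have : (i %/ l < 2)%N by rewrite ltn_divLR.
  have : (j %/ l < 2)%N by rewrite ltn_divLR.
  move: (i %/ l)%N (j %/ l)%N (j %% l)%N => qi qj m ltj2 lti2 ej ei.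
  suff -> : i = j by [].
  apply: val_inj; rewrite /= ei ej; congr (_ * _ + _)%N.
  move: eq_odd; rewrite ei ej !oddD !oddM odd_l !andbT => /addIb.
  by case: qi qj lti2 ltj2 {ei ej} => [|[|qi]] [|[|qj]].
move=> eq_x; exfalso; move: eq_x; rewrite /x.
wlog lt_m : i j {lti ltj neq_m} / (i %% l < j %% l)%N.
  move=> th; move: neq_m; rewrite neq_ltn => /orP[/th|/th h] //.
  by move=> e; apply: h.
have := disj (i %% l)%N (j %% l)%N; rewrite lt_m ltm => /(_ isT).
by case/and4P => /eqP h1 /eqP h2 /eqP h3 /eqP h4; case: (odd i); case: (odd j).
Qed.

(** Pairing three vertices of [A] with three of [B] gives a ladder with three rungs. *)
Lemma K33_cdia (G : sgraph) (A B : {set G}) :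
  (2 < #|A|)%N -> (2 < #|B|)%N -> (forall x y, x \in A -> y \in B -> adj x y) ->
  contains G (cdia 3).
Proof.
move=> A3 B3 AB; have [x0 _] : exists x, x \in A.
  by apply/set0Pn; rewrite -card_gt0; apply: leq_trans A3.
pose a := nth x0 (enum A); pose b := nth x0 (enum B).
have aA i : (i < 3)%N -> a i \in A.
  by move=> lti; rewrite -mem_enum mem_nth // -cardE (leq_trans lti).
have bB i : (i < 3)%N -> b i \in B.
  by move=> lti; rewrite -mem_enum mem_nth // -cardE (leq_trans lti).
have lt_mod i : (i %% 3 < 3)%N by rewrite ltn_mod.
have neq_ab i j : (i < 3)%N -> (j < 3)%N -> a i != b j.
  move=> lti ltj; have := AB _ _ (aA i lti) (bB j ltj).
  by apply: contraTneq => ->; rewrite adj_irrefl.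
apply: (@odd_ladder_cdia G 3 a b) => // [i lti|i lti|i lti|i j /andP[lt_ij ltj]].
- by rewrite AB ?aA ?bB.
- by rewrite AB ?aA ?bB.
- by rewrite adj_sym AB ?aA ?bB.
have lti := ltn_trans lt_ij ltj.
rewrite cardE in A3; rewrite cardE in B3.
rewrite neq_ab // [b i == _]eq_sym neq_ab // !nth_uniq ?enum_uniq //.
- by rewrite neq_ltn lt_ij.
- exact: leq_trans B3.
- exact: leq_trans B3.
- exact: leq_trans A3.
- exact: leq_trans A3.
Qed.

(** * Weighted codegrees and well-spread sets of rungs *)

Section Rungs.
Variables (R : realFieldType) (G : sgraph).
Implicit Types (F : {set G * G}) (a b : G).

Definition deg b := #|[set a : G | adj a b]|.
Definition wgt b : R := (deg b)%:R^-1.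
Definition ends F b := [set a | (a, b) \in F].
Definition common F a a' := [set b | ((a, b) \in F) && ((a', b) \in F)].
(** This is the normalizing constant for choosing the next common neighbour with probability
    proportional to [wgt]. *)
Definition wcodeg F a a' := \sum_(b in common F a a') wgt b.

Lemma wgt_ge0 b : 0 <= wgt b. Proof. by rewrite invr_ge0. Qed.

Lemma wcodeg_ge0 F a a' : 0 <= wcodeg F a a'.
Proof. by apply: sumr_ge0 => b _; apply: wgt_ge0. Qed.

Lemma wcodegC F a a' : wcodeg F a a' = wcodeg F a' a.
Proof. by apply: eq_bigl => b; rewrite !inE andbC. Qed.

Lemma wcodegS F F' a a' : F' \subset F -> wcodeg F' a a' <= wcodeg F a a'.
Proof.
move=> sF; rewrite [leRHS]big_mkcond [leLHS]big_mkcond; apply: ler_sum => b _.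
rewrite !inE; case: ifP => [/andP[ab a'b]|_].
  by rewrite !(subsetP sF).
by case: ifP => _ //; apply: wgt_ge0.
Qed.

Lemma sum_over_rungs (f : G * G -> R) F :
  \sum_(e in F) f e = \sum_b \sum_(a in ends F b) f (a, b).
Proof.
rewrite big_mkcond (eq_bigr (fun e => (fun a b => if (a, b) \in F then f (a, b) else 0) e.1 e.2)); last by case.
rewrite -(pair_bigA _ (fun a b => if (a, b) \in F then f (a, b) else 0)) exchange_big /=.
by apply: eq_bigr => b _; rewrite [RHS]big_mkcond; apply: eq_bigr => a _; rewrite inE.
Qed.

Lemma card_rungs F : #|F|%:R = \sum_b #|ends F b|%:R :> R.
Proof.
rewrite -sum1_card natr_sum (sum_over_rungs (fun=> 1)); apply: eq_bigr => b _.
by rewrite sumr_const.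
Qed.

(* [F] maximizes a potential in which the truncated weighted codegrees are
   penalized; local optimality under deleting one rung, or all rungs at one
   vertex, yields the two conclusions. *)
Lemma well_spread_rungs (D c eta : R) (E0 := [set e : G * G | adj e.1 e.2 & D <= (deg e.2)%:R]) :
  0 < eta <= 1 -> 0 <= c -> #|G|%:R ^+ 2 * c < eta ^+ 2 * #|E0|%:R ->
  exists F : {set G * G}, [/\ F != set0, F \subset E0,
    forall e, e \in F -> (1 - eta) * (deg e.2)%:R <= #|ends F e.2|%:R &
    forall e, e \in F ->
      #|[set a' in ends F e.2 | wcodeg F e.1 a' <= c]|%:R * wgt e.2 <= eta].
Proof.
case/andP=> eta0 eta1 c0 E0_big.
pose L F := \sum_a \sum_a' Num.min (wcodeg F a a') c.
pose sndF F := [set e.2 | e in F].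
(* Every vertex [b] in use is charged [(1 - eta) * deg b], and light pairs are favoured by the
   truncation at [c] in [L]. *)
pose Phi F := #|F|%:R - (1 - eta) * (\sum_(b in sndF F) (deg b)%:R) - eta^-1 * L F.
have etaV0 : 0 < eta^-1 by rewrite invr_gt0.
have L0 : L set0 = 0.
  rewrite /L big1 // => a _; rewrite big1 // => a' _.
  by rewrite /wcodeg big1 ?min_l // => b; rewrite !inE.
have LE0 F : L F <= #|G|%:R ^+ 2 * c.
  apply: (@le_trans _ _ (\sum_(a : G) \sum_(a' : G) c)).
    by apply: ler_sum => a _; apply: ler_sum => a' _; rewrite ge_min lexx orbT.
  rewrite !sumr_const -mulrnA -[leLHS]mulr_natl natrM expr2 lexx //.
have LS F F' : F' \subset F -> L F' <= L F.
  move=> sF; apply: ler_sum => a _; apply: ler_sum => a' _.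
  by rewrite le_min ge_min wcodegS //= ge_min lexx orbT.
(* Each [b] used by [E0] carries all its [deg b] rungs, so the first two terms leave [eta * #|E0|],
   which exceeds the largest possible penalty. *)
have PhiE0 : 0 < Phi E0.
  rewrite /Phi; have -> : \sum_(b in sndF E0) (deg b)%:R = #|E0|%:R :> R.
    rewrite card_rungs [RHS](bigID (mem (sndF E0))) /= [X in _ = _ + X]big1 ?addr0.
      apply: eq_bigr => b /imsetP[[a b'] /=]; rewrite inE /= => /andP[_ Db] ->.
      by congr _%:R; apply: eq_card => a'; rewrite !inE Db andbT.
    move=> b nb; rewrite (_ : ends _ _ = set0) ?cards0 //; apply/setP=> a.
    rewrite !in_set0 in_set; apply: contraNF nb => abE.
    by apply/imsetP; exists (a, b).
  have := ler_wpM2l (ltW etaV0) (LE0 E0).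
  have : eta^-1 * (#|G|%:R ^+ 2 * c) < eta * #|E0|%:R.
    by rewrite [ltLHS]mulrC ltr_pdivrMr // [ltRHS]mulrAC -expr2.
  by lra.
have [F sF maxF] : exists2 F : {set G * G}, F \subset E0 &
    forall F' : {set G * G}, F' \subset E0 -> Phi F' <= Phi F.
  case: (@arg_maxP _ _ _ E0 (fun F : {set G * G} => F \subset E0) Phi (subxx _)) => F sF maxF.
  by exists F.
exists F; split=> // [|[a b] abF /=|[a b] abF /=].
- apply: contraTneq (lt_le_trans PhiE0 (maxF _ (subxx _))) => ->.
  rewrite /Phi L0 cards0 big1 ?mulr0 ?subr0 ?ltxx // => b.
  by rewrite /sndF imset0 inE.
(* Deleting all rungs at [b] loses [#|ends F b|], refunds [(1 - eta) * deg b] and does not increase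
   [L]. *)
- pose F' := [set e in F | e.2 != b].
  have sF' : F' \subset F by apply/subsetP => e; rewrite inE => /andP[].
  have := maxF F' (subset_trans sF' sF); rewrite /Phi.
  have := ler_wpM2l (ltW etaV0) (LS _ _ sF').
  have -> : \sum_(b0 in sndF F) (deg b0)%:R =
      (deg b)%:R + \sum_(b0 in sndF F') (deg b0)%:R :> R.
    rewrite (bigD1 b) /=; last by apply/imsetP; exists (a, b).
    congr (_ + _); apply: eq_bigl => b0; apply/andP/imsetP.
      by case=> /imsetP[e eF ->] ne; exists e; rewrite ?inE ?eF.
    by case=> e; rewrite inE => /andP[eF ne] ->; split=> //; apply/imsetP; exists e.
  have -> : #|F|%:R = #|ends F b|%:R + #|F'|%:R :> R.
    rewrite !card_rungs (bigD1 b) //= [X in _ = _ + X](bigD1 b) //=.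
    rewrite (_ : ends F' b = set0) ?cards0 ?add0r; last first.
      by apply/setP => a0; rewrite !inE eqxx andbF.
    congr (_ + _); apply: eq_bigr => b0 ne; congr _%:R.
    by apply: eq_card => a0; rewrite !inE ne andbT.
  rewrite mulrDr; lra.
(* Deleting one rung loses 1, while [L] drops by at least [wgt b] for each light [a']; optimality
   bounds their number. *)
pose F' := F :\ (a, b); have sF' : F' \subset F := subD1set _ _.
set X := [set a' in _ | _].
have := maxF F' (subset_trans sF' sF); rewrite /Phi.
have -> : #|F|%:R = 1 + #|F'|%:R :> R by rewrite (cardsD1 (a, b) F) abF natrD.
have : (1 - eta) * (\sum_(b0 in sndF F') (deg b0)%:R) <=
       (1 - eta) * (\sum_(b0 in sndF F) (deg b0)%:R) :> R.
  apply: ler_wpM2l; first by lra.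
  rewrite [leRHS]big_mkcond [leLHS]big_mkcond; apply: ler_sum => b0 _.
  case: ifP => [/imsetP[e eF' ->]|_]; last by case: ifP.
  by rewrite imset_f // (subsetP sF').
suff : #|X|%:R * wgt b + L F' <= L F.
  move=> /(ler_wpM2l (ltW etaV0)); rewrite mulrDr => h1 h2 h3.
  by rewrite -[leRHS]mulr1 -ler_pdivrMl //; lra.
rewrite /L [leRHS](bigD1 a) //= [X in _ + X](bigD1 a) //= addrA; apply: lerD; last first.
  apply: ler_sum => a0 _; apply: ler_sum => a' _.
  by rewrite le_min ge_min wcodegS //= ge_min lexx orbT.
rewrite mulr_natl -sumr_const [X in X + _]big_mkcond -big_split /=.
apply: ler_sum => a' _; case: ifP => [|_]; last first.
  by rewrite add0r le_min ge_min wcodegS //= ge_min lexx orbT.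
rewrite inE => /andP[]; rewrite inE => a'b le_c; rewrite (min_l le_c).
suff -> : wcodeg F a a' = wgt b + wcodeg F' a a' by rewrite lerD2l ge_min lexx.
rewrite /wcodeg (bigD1 b) /=; last by rewrite inE abF.
congr (_ + _); apply: eq_bigl => b0; rewrite !inE !xpair_eqE.
have [->|] := eqVneq b0 b; first by rewrite !eqxx !andbF.
by move=> _; rewrite !andbF !andbT.
Qed.
End Rungs.

(** * The weighted walk on rungs *)

Lemma weighted_pair_bound (R : realFieldType) (I : finType) (C : {set I})
    (w x y : I -> R) : (forall i, 0 <= w i) ->
  \sum_(i in C) w i * (x i * y i) - 2^-1 * \sum_(i in C) w i * (x i ^+ 2 + y i ^+ 2) <=
  2 * ((\sum_(i in C) w i * x i) * (\sum_(i in C) w i * y i) / \sum_(i in C) w i).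
Proof.
move=> w0; set W := \sum_(i in C) w i; set P := \sum_(i in C) _ * x _.
set Q := \sum_(i in C) _ * y _.
have [W0|Wneq0] := eqVneq W 0.
  have w_eq0 i : i \in C -> w i = 0.
    by move=> iC; apply: (psumr_eq0P (P := mem C) _ W0) => // j _.
  rewrite W0 invr0 !mulr0 !big1 ?mulr0 ?subr0 // => i /w_eq0 ->; exact: mul0r.
have Wgt0 : 0 < W by rewrite lt_neqAle eq_sym Wneq0 sumr_ge0.
(* With [t] the difference of the means, this is [(EX - EY)^2 <= E(X - Y)^2], combined with
   [4 EX EY >= - (EX - EY)^2]. *)
set t := (P - Q) / W.
have tW : t * W = P - Q by rewrite /t divfK.
have : 0 <= \sum_(i in C) w i * (x i - y i - t) ^+ 2.
  by apply: sumr_ge0 => i _; rewrite mulr_ge0 ?sqr_ge0.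
have -> : \sum_(i in C) w i * (x i - y i - t) ^+ 2 =
    \sum_(i in C) w i * (x i ^+ 2 + y i ^+ 2) - 2 * (\sum_(i in C) w i * (x i * y i))
    - 2 * t * (P - Q) + t ^+ 2 * W.
  rewrite /P /Q /W !mulr_sumr -!sumrB mulr_sumr -!sumrB -big_split /=.
  by apply: eq_bigr => i _; ring.
have -> : t ^+ 2 * W = t * (P - Q) by rewrite expr2 -mulrA tW.
have -> : P * Q / W = (((P + Q) ^+ 2 / W) - (P - Q) ^+ 2 / W) / 4.
  by field; rewrite Wneq0.
have -> : t * (P - Q) = (P - Q) ^+ 2 / W by rewrite /t expr2 mulrAC.
have -> : 2 * t * (P - Q) = 2 * ((P - Q) ^+ 2 / W) by rewrite -mulrA /t expr2 mulrAC.
have : 0 <= (P + Q) ^+ 2 / W by rewrite divr_ge0 ?sqr_ge0 // ltW.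
lra.
Qed.

Lemma sum_pair (V : nmodType) (I J : finType) (f : I * J -> V) :
  \sum_e f e = \sum_i \sum_j f (i, j).
Proof. by rewrite pair_bigA /=; apply: eq_bigr => -[]. Qed.

Section LadderOperator.
Variables (R : realFieldType) (G : sgraph) (F : {set G * G}) (D c th eta : R).
Hypotheses (adjF : forall e, e \in F -> adj e.1 e.2)
  (degF : forall e, e \in F -> D <= (deg e.2)%:R) (D0 : 0 < D) (c0 : 0 < c)
  (th0 : 0 <= th).
Implicit Types (a b : G) (e : G * G).
Local Notation wt := (@wgt R G).
Local Notation W := (wcodeg R F).

Definition codeg b b' := #|ends F b :&: ends F b'|.

(* The walk "from [(a, b)] choose [a'] adjacent to [b], then a common neighbour
   [b'] of [a] and [a'] with probability proportional to [wgt b']", where the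
   first choice has probability [1 / deg b] for each [a'] in [ends F b]. *)
Definition full_step e e' : R :=
  if [&& e \in F, (e'.1, e.2) \in F, (e.1, e'.2) \in F & e' \in F]
  then wt e.2 * wt e'.2 / W e.1 e'.1 else 0.

(** Distinct ends make consecutive rungs disjoint, the lower bound on [W] makes each single step
    light, and the bound on [codeg] limits the probability of hitting a given [b']. *)
Definition allowed e e' := [&& e.1 != e'.1, e.2 != e'.2, c < W e.1 e'.1 &
  (codeg e.2 e'.2)%:R <= th * ((deg e.2)%:R + (deg e'.2)%:R)].

Definition step e e' : R := if allowed e e' then full_step e e' else 0.

Lemma full_stepC e e' : full_step e e' = full_step e' e.
Proof.
rewrite /full_step wcodegC [wt e.2 * _]mulrC; congr (if _ then _ else _).
by do 4![case: (_ \in F)].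
Qed.

Lemma stepC e e' : step e e' = step e' e.
Proof.
rewrite /step full_stepC /allowed wcodegC /codeg setIC [_%:R + _]addrC.
by rewrite [e.1 == _]eq_sym [e.2 == _]eq_sym.
Qed.

Lemma full_step_ge0 e e' : 0 <= full_step e e'.
Proof.
rewrite /full_step; case: ifP => // _.
by rewrite divr_ge0 ?mulr_ge0 ?wgt_ge0 ?wcodeg_ge0.
Qed.

Lemma step_ge0 e e' : 0 <= step e e'.
Proof. by rewrite /step; case: ifP => // _; apply: full_step_ge0. Qed.

Lemma step_le_full e e' : step e e' <= full_step e e'.
Proof. by rewrite /step; case: ifP => // _; apply: full_step_ge0. Qed.

Lemma deg_gt0 a b : (a, b) \in F -> 0 < (deg b)%:R :> R.
Proof. by move/degF; apply: lt_le_trans. Qed.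

Lemma wgt_gt0 a b : (a, b) \in F -> 0 < wt b.
Proof. by rewrite invr_gt0; apply: deg_gt0. Qed.

Lemma wgt_le a b : (a, b) \in F -> wt b <= D^-1.
Proof. by move=> abF; rewrite lef_pV2 ?posrE ?(degF abF) // (deg_gt0 abF). Qed.

Lemma card_ends_le b : (#|ends F b| <= deg b)%N.
Proof. by apply/subset_leq_card/subsetP => a; rewrite !inE => /adjF. Qed.

Lemma wgt_ends_le b (n : nat) : (n <= deg b)%N -> n%:R * wt b <= 1.
Proof.
have [->|d0] := posnP (deg b); first by rewrite leqn0 => /eqP->; rewrite mul0r ler01.
by move=> le_n; rewrite ler_pdivrMr ?ltr0n // mul1r ler_nat.
Qed.

Lemma wcodeg_ge2 a a' b b' : (a, b) \in F -> (a', b) \in F -> (a, b') \in F ->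
  (a', b') \in F -> b != b' -> wt b + wt b' <= W a a'.
Proof.
move=> ab a'b ab' a'b' ne; rewrite /wcodeg (bigD1 b) /= ?inE ?ab ?a'b // lerD2l.
rewrite (bigD1 b') /= ?inE ?ab' ?a'b' 1?eq_sym // lerDl.
by apply: sumr_ge0 => ? _; apply: wgt_ge0.
Qed.

Lemma sum_full_step_fst a b a' :
  \sum_b' full_step (a, b) (a', b') = if ((a, b) \in F) && ((a', b) \in F) then wt b else 0.
Proof.
case: ifP => [/andP[ab a'b]|h]; last first.
  by apply: big1 => b' _; rewrite /full_step /= andbA h.
have W_gt0 : 0 < W a a'.
  rewrite /wcodeg (bigD1 b) /= ?inE ?ab ?a'b //.
  by rewrite ltr_pwDl ?(wgt_gt0 ab) // sumr_ge0 // => ? _; apply: wgt_ge0.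
transitivity (\sum_(b' in common F a a') wt b * wt b' / W a a').
  rewrite [RHS]big_mkcond; apply: eq_bigr => b' _.
  by rewrite /full_step /= ab a'b inE.
by rewrite -mulr_suml -mulr_sumr mulfK ?gt_eqF.
Qed.

Lemma sum_full_step e : \sum_e' full_step e e' =
  if e \in F then #|ends F e.2|%:R * wt e.2 else 0.
Proof.
case: e => a b /=; rewrite sum_pair; under eq_bigr => a' _ do rewrite sum_full_step_fst.
case: ifP => ab /=; last exact: big1.
rewrite mulr_natl -sumr_const [RHS]big_mkcond.
by apply: eq_bigr => a' _; rewrite inE.
Qed.

Lemma full_step_row_le1 e : \sum_e' full_step e e' <= 1.
Proof.
by rewrite sum_full_step; case: ifP => // _; apply/wgt_ends_le/card_ends_le.
Qed.

(* Summing [weighted_pair_bound] over all pairs [(a, a')] compares the form with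
   [\sum_b wgt b * (\sum_a x (a, b)) ^+ 2], which is nonnegative. *)
Lemma full_step_form_ge (x : G * G -> R) :
  - 2^-1 * \sum_e x e ^+ 2 <= \sum_e \sum_e' full_step e e' * x e * x e'.
Proof.
pose i a b : R := ((a, b) \in F)%:R; pose z a b := i a b * x (a, b).
have iK a b : i a b * i a b = i a b by rewrite /i; case: (_ \in F); rewrite ?mul1r ?mul0r.
have ii f a a' : \sum_(b in common F a a') f b = \sum_b i a b * i a' b * f b :> R.
  rewrite big_mkcond; apply: eq_bigr => b _; rewrite inE /i.
  by do 2![case: (_ \in F)]; rewrite /= ?mul1r ?mul0r.
have -> : \sum_e \sum_e' full_step e e' * x e * x e' = \sum_a \sum_a'
    (\sum_(b in common F a a') wt b * x (a, b)) *
    (\sum_(b in common F a a') wt b * x (a', b)) / W a a'.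
  rewrite sum_pair; apply: eq_bigr => a _.
  under eq_bigr => b _ do rewrite sum_pair.
  rewrite exchange_big; apply: eq_bigr => a' _ /=.
  rewrite mulr_suml mulr_suml [RHS]big_mkcond; apply: eq_bigr => b _.
  rewrite inE; case: ifP => [/andP[ab a'b]|h]; last first.
    by apply: big1 => b' _; rewrite /full_step /= andbA h !mul0r.
  rewrite mulr_sumr mulr_suml [RHS]big_mkcond; apply: eq_bigr => b' _.
  rewrite /full_step /= ab a'b inE /=; case: (_ && _); last by rewrite !mul0r.
  by ring.
have : \sum_a \sum_a' (\sum_(b in common F a a') wt b * (x (a, b) * x (a', b)) -
    2^-1 * \sum_(b in common F a a') wt b * (x (a, b) ^+ 2 + x (a', b) ^+ 2)) <=
  \sum_a \sum_a' 2 * ((\sum_(b in common F a a') wt b * x (a, b)) *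
    (\sum_(b in common F a a') wt b * x (a', b)) / W a a').
  do 2![apply: ler_sum => ? _].
  by apply: weighted_pair_bound => b; apply: wgt_ge0.
under eq_bigr => a _ do rewrite sumrB -mulr_sumr.
rewrite sumrB -mulr_sumr.
under [leRHS]eq_bigr => a _ do rewrite -mulr_sumr.
rewrite -mulr_sumr.
have -> : \sum_a \sum_a' \sum_(b in common F a a') wt b * (x (a, b) * x (a', b)) =
    \sum_b wt b * (\sum_a z a b) ^+ 2.
  under eq_bigr => a _ do (under eq_bigr => a' _ do rewrite ii; rewrite exchange_big).
  rewrite exchange_big /=; apply: eq_bigr => b _.
  rewrite expr2 big_distrlr mulr_sumr; apply: eq_bigr => a _ /=.
  by rewrite mulr_sumr; apply: eq_bigr => a' _; rewrite /z; ring.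
have J0 : 0 <= \sum_b wt b * (\sum_a z a b) ^+ 2.
  by apply: sumr_ge0 => b _; rewrite mulr_ge0 ?sqr_ge0 ?wgt_ge0.
have N_le : \sum_a \sum_a' \sum_(b in common F a a')
    wt b * (x (a, b) ^+ 2 + x (a', b) ^+ 2) <= 2 * \sum_e x e ^+ 2.
  have half : \sum_a \sum_a' \sum_(b in common F a a') wt b * x (a, b) ^+ 2 <=
      \sum_e x e ^+ 2.
    rewrite sum_pair; apply: ler_sum => a _.
    under eq_bigr => a' _ do rewrite ii.
    rewrite exchange_big; apply: ler_sum => b _ /=.
    apply: (@le_trans _ _ (#|ends F b|%:R * wt b * x (a, b) ^+ 2)); last first.
      by rewrite ler_piMl ?sqr_ge0 // wgt_ends_le ?card_ends_le.
    rewrite -mulrA mulr_natl -sumr_const [leRHS]big_mkcond; apply: ler_sum => a' _.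
    have p0 : 0 <= wt b * x (a, b) ^+ 2 by rewrite mulr_ge0 ?sqr_ge0 ?wgt_ge0.
    by rewrite inE /i; do 2![case: (_ \in F)]; rewrite /= ?mul1r ?mul0r.
  have -> : \sum_a \sum_a' \sum_(b in common F a a')
      wt b * (x (a, b) ^+ 2 + x (a', b) ^+ 2) =
      \sum_a \sum_a' \sum_(b in common F a a') wt b * x (a, b) ^+ 2 +
      \sum_a \sum_a' \sum_(b in common F a a') wt b * x (a, b) ^+ 2.
    rewrite [X in _ = _ + X]exchange_big -big_split; apply: eq_bigr => a _ /=.
    rewrite -big_split; apply: eq_bigr => a' _ /=.
    rewrite [X in _ = _ + X](eq_bigl (mem (common F a a'))); last first.
      by move=> b; rewrite /= !inE andbC.
    by rewrite -big_split; apply: eq_bigr => b _ /=; rewrite mulrDr.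
  lra.
lra.
Qed.

(** Both [b] and [b'] count in [W], so each term is at most [wt b * wt b' / (wt b + wt b')], that is
    [1 / (deg b + deg b')], and there are at most [codeg b b'] terms. *)
Lemma sum_full_step_snd_le a b b' : b != b' ->
  (codeg b b')%:R <= th * ((deg b)%:R + (deg b')%:R) ->
  \sum_a' full_step (a, b) (a', b') <= th.
Proof.
move=> ne le_co.
apply: (@le_trans _ _ (\sum_(a' in ends F b :&: ends F b') ((deg b)%:R + (deg b')%:R)^-1)).
  rewrite [leRHS]big_mkcond; apply: ler_sum => a' _; rewrite /full_step /= !inE.
  case: ifP => [/and4P[ab a'b ab' a'b']|_]; last first.
    by case: ifP => _; rewrite ?invr_ge0 ?addr_ge0.
  rewrite a'b a'b' /=.
  have db := deg_gt0 ab; have db' := deg_gt0 ab'.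
  have w0 := wgt_gt0 ab; have w0' := wgt_gt0 ab'.
  apply: (@le_trans _ _ (wt b * wt b' / (wt b + wt b'))).
    apply: ler_wpM2l; first by rewrite mulr_ge0 ?wgt_ge0.
    rewrite lef_pV2 ?posrE ?addr_gt0 //; first exact: wcodeg_ge2.
    by apply: lt_le_trans (wcodeg_ge2 ab a'b ab' a'b' ne); rewrite addr_gt0.
  rewrite le_eqVlt; apply/orP; left; apply/eqP; rewrite /wgt.
  by field; rewrite !gt_eqF ?addr_gt0 ?invr_gt0.
rewrite sumr_const -[_ *+ _]mulr_natl.
have [->|d0] := eqVneq ((deg b)%:R + (deg b')%:R : R) 0; first by rewrite invr0 mulr0.
by rewrite ler_pdivrMr // lt_neqAle eq_sym d0 addr_ge0.
Qed.

Definition on_rung v : pred (G * G) := fun e => (v == e.1) || (v == e.2).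

Lemma step_disjoint e e' v : step e e' != 0 -> on_rung v e -> ~~ on_rung v e'.
Proof.
rewrite /step /allowed; case: ifP => [/and4P[ne1 ne2 _ _]|]; last by rewrite eqxx.
rewrite /full_step; case: ifP => [/and4P[_ /adjF/= adj1 /adjF/= adj2 _] _|]; last by rewrite eqxx.
rewrite /on_rung negb_or => /orP[/eqP->|/eqP->].
  by rewrite ne1; apply: contraTneq adj2 => ->; rewrite adj_irrefl.
by rewrite ne2 andbT; apply: contraTneq adj1 => <-; rewrite adj_irrefl.
Qed.

Lemma step_mem e e' : step e e' != 0 -> e' \in F.
Proof.
rewrite /step; case: ifP => _; last by rewrite eqxx.
by rewrite /full_step; case: ifP => [/and4P[]|]; rewrite ?eqxx.
Qed.

(** The vertex is hit either as [a'], with probability at most [wt b <= D^-1], or as [b'], with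
    probability at most [th]. *)
Lemma step_conflict v e : \sum_(e' | on_rung v e') step e e' <= D^-1 + th.
Proof.
case: e => a b.
apply: (@le_trans _ _ (\sum_b' step (a, b) (v, b') + \sum_a' step (a, b) (a', v))).
  rewrite big_mkcond sum_pair.
  apply: (@le_trans _ _ (\sum_a' \sum_b' ((if v == a' then step (a, b) (a', b') else 0) +
      (if v == b' then step (a, b) (a', b') else 0)))).
    apply: ler_sum => a' _; apply: ler_sum => b' _; rewrite /on_rung /=.
    by case: eqP => _; case: eqP => _; rewrite /= ?addr0 ?add0r ?lerDl ?step_ge0.
  under eq_bigr => a' _ do rewrite big_split /=.
  rewrite big_split /= lerD //.
    rewrite exchange_big; apply: ler_sum => b' _ /=.
    by rewrite -big_mkcond (big_pred1 v) // => u; rewrite eq_sym.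
  apply: ler_sum => a' _ /=.
  by rewrite -big_mkcond (big_pred1 v) // => u; rewrite eq_sym.
apply: lerD.
  apply: le_trans (ler_sum _ (fun b' _ => step_le_full _ _)) _.
  rewrite sum_full_step_fst; case: ifP => [/andP[ab _]|_]; first exact: wgt_le ab.
  by rewrite invr_ge0 ltW.
have [->|ne] := eqVneq b v.
  by rewrite big1 // => a' _; rewrite /step /allowed /= eqxx andbF.
have [le_co|gt_co] := boolP ((codeg b v)%:R <= th * ((deg b)%:R + (deg v)%:R)).
  apply: le_trans (sum_full_step_snd_le a ne le_co).
  by apply: ler_sum => a' _; apply: step_le_full.
by rewrite big1 // => a' _; rewrite /step /allowed /= (negPf gt_co) !andbF.
Qed.

Definition superheavy b := [set b' | b' != b &
  th * ((deg b)%:R + (deg b')%:R) < (codeg b b')%:R].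

Section FewTriples.
Hypotheses (thD : 4 <= th ^+ 2 * D)
  (triple_le2 : forall b b' b'', uniq [:: b; b'; b''] ->
    (#|ends F b :&: ends F b' :&: ends F b''| <= 2)%N).

(* The sets [ends F b :&: ends F b'] with [b'] superheavy are large subsets of
   [ends F b] with pairwise intersections of size at most 2, so by the
   Cauchy-Schwarz inequality they nearly do not overlap. *)
Lemma sum_superheavy a b : (a, b) \in F ->
  \sum_(b' in superheavy b) (codeg b b')%:R <= 2 * (deg b)%:R :> R.
Proof.
move=> abF; set SH := superheavy b; set s := \sum_(b' in SH) _.
set d : R := (deg b)%:R; have d0 : 0 < d := deg_gt0 abF.
have Dd : D <= d := degF abF.
have s0 : 0 <= s by apply: sumr_ge0.
pose m : R := #|SH|%:R.
have m_le : m * (th * d) <= s.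
  rewrite mulr_natl -sumr_const; apply: ler_sum => b'; rewrite inE => /andP[_ /ltW].
  by apply: le_trans; rewrite mulrDr lerDl mulr_ge0.
pose cnt a' : R := \sum_(b' in SH) (a' \in ends F b')%:R.
have cntE b' : (codeg b b')%:R = \sum_(a' in ends F b) (a' \in ends F b')%:R :> R.
  rewrite /codeg -sum1_card natr_sum big_mkcond [RHS]big_mkcond.
  by apply: eq_bigr => a' _; rewrite in_setI; do 2![case: (a' \in _)].
have sE : s = \sum_(a' in ends F b) cnt a'.
  by rewrite exchange_big /=; apply: eq_bigr => b' _; apply: cntE.
have cnt2 : \sum_(a' in ends F b) cnt a' ^+ 2 <= s + 2 * m ^+ 2.
  have -> : \sum_(a' in ends F b) cnt a' ^+ 2 = \sum_(b' in SH) \sum_(b'' in SH)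
      #|ends F b :&: ends F b' :&: ends F b''|%:R.
    under eq_bigr => a' _ do rewrite expr2 big_distrlr /=.
    rewrite exchange_big; apply: eq_bigr => b' _ /=.
    rewrite exchange_big; apply: eq_bigr => b'' _ /=.
    rewrite -sum1_card natr_sum [LHS]big_mkcond [RHS]big_mkcond; apply: eq_bigr => a' _.
    by rewrite !in_setI; do 3![case: (a' \in _)]; rewrite /= ?mulr1 ?mulr0 ?mul0r.
  have -> : s + 2 * m ^+ 2 = \sum_(b' in SH) ((codeg b b')%:R + \sum_(b'' in SH) 2).
    rewrite big_split /= !sumr_const -/s -[_ *+ _ *+ _]mulr_natl -[2 *+ _]mulr_natl -/m.
    by rewrite expr2; ring.
  apply: ler_sum => b' b'SH; rewrite (bigD1 b') //=; apply: lerD.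
    by rewrite ler_nat /codeg subset_leq_card // subsetIl.
  rewrite [leRHS](bigD1 b') //=; apply: ler_wpDl => //.
  apply: ler_sum => b'' /andP[b''SH ne]; rewrite ler_nat; apply: triple_le2.
  move: b'SH b''SH; rewrite !inE => /andP[n1 _] /andP[n2 _].
  by rewrite /= !inE !negb_or eq_sym n1 eq_sym n2 eq_sym ne.
have CS : s ^+ 2 <= d * (s + 2 * m ^+ 2).
  pose t := s / d; have td : t * d = s by rewrite /t divfK ?gt_eqF.
  have : 0 <= \sum_(a' in ends F b) (cnt a' - t) ^+ 2.
    by apply: sumr_ge0 => a' _; apply: sqr_ge0.
  have -> : \sum_(a' in ends F b) (cnt a' - t) ^+ 2 =
      \sum_(a' in ends F b) cnt a' ^+ 2 - 2 * t * s + #|ends F b|%:R * t ^+ 2.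
    have -> : #|ends F b|%:R * t ^+ 2 = \sum_(a' in ends F b) t ^+ 2.
      by rewrite sumr_const mulr_natl.
    rewrite sE mulr_sumr -sumrB -big_split /=.
    by apply: eq_bigr => a' _; ring.
  have : #|ends F b|%:R * t ^+ 2 <= d * t ^+ 2.
    by apply: ler_wpM2r; rewrite ?sqr_ge0 // ler_nat card_ends_le.
  have -> : d * t ^+ 2 = t * s by rewrite -td; ring.
  have -> : s ^+ 2 = d * (t * s) by rewrite -[in RHS]td -td; ring.
  move=> h1 h2; apply: ler_wpM2l; first exact: ltW.
  lra.
(* From [m * th * d <= s] and [th ^+ 2 * d >= 4]. Then [CS] gives [s ^+ 2 <= d * s + s ^+ 2 / 2], so
   [s <= 2 * d]. *)
have m2 : 4 * (d * m ^+ 2) <= s ^+ 2.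
  have mthd0 : 0 <= m * (th * d) by rewrite !mulr_ge0 // ltW.
  apply: le_trans (lerXn2r 2 mthd0 s0 m_le); rewrite (_ : (m * (th * d)) ^+ 2 = th ^+ 2 * d * (d * m ^+ 2)); last by ring.
  apply: ler_wpM2r; first by rewrite mulr_ge0 ?sqr_ge0 // ltW.
  by apply: le_trans thD _; rewrite ler_wpM2l ?sqr_ge0.
have [s_eq0|s_neq0] := eqVneq s 0; first by rewrite s_eq0 mulr_ge0 // ltW.
have s_gt0 : 0 < s by rewrite lt_neqAle eq_sym s_neq0.
rewrite -(ler_pM2l s_gt0); nra.
Qed.

(** The four terms bound the mass lost to [a' = a], to light pairs, to [b' = b] and to superheavy
    [b']. *)
Lemma forbidden_row e : e \in F ->
  #|[set a' in ends F e.2 | W e.1 a' <= c]|%:R * wt e.2 <= eta ->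
  \sum_e' (full_step e e' - step e e') <= D^-1 + eta + (c * D)^-1 + 2 * (c * D)^-1.
Proof.
case: e => a b /= abF light; have w_le := wgt_le abF; have w0 := ltW (wgt_gt0 abF).
have cV0 : 0 < c^-1 by rewrite invr_gt0.
have DV0 : 0 < D^-1 by rewrite invr_gt0.
have cD0 : 0 <= (c * D)^-1 by rewrite invr_ge0 mulr_ge0 // ltW.
pose M a' b' := full_step (a, b) (a', b').
have M0 a' b' : 0 <= M a' b' := full_step_ge0 _ _.
(* Away from light pairs, a single step weighs at most [wt b / (c * D)]. *)
have M_le a' b' : c < W a a' -> M a' b' <=
    if (a' \in ends F b) && (a' \in ends F b') then wt b * (c * D)^-1 else 0.
  move=> lt_c; rewrite /M /full_step /= !inE; case: ifP => [/and4P[_ a'b ab' a'b']|_].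
    rewrite a'b a'b' /= invfM -mulrA; apply: ler_wpM2l => //.
    rewrite mulrC; apply: ler_pM; rewrite ?invr_ge0 ?wcodeg_ge0 ?wgt_ge0 //.
      by rewrite lef_pV2 ?posrE //; [apply: ltW | apply: lt_trans lt_c].
    exact: wgt_le ab'.
  by case: ifP => _ //; rewrite mulr_ge0.
pose T1 a' b' := if a' == a then M a' b' else 0.
pose T2 a' b' := if W a a' <= c then M a' b' else 0.
pose T3 a' b' := if (c < W a a') && (b' == b) then M a' b' else 0.
pose T4 a' b' := if (c < W a a') && (b' \in superheavy b) then M a' b' else 0.
apply: (@le_trans _ _ (\sum_a' \sum_b' (T1 a' b' + T2 a' b' + T3 a' b' + T4 a' b'))).
  rewrite sum_pair; apply: ler_sum => a' _; apply: ler_sum => b' _.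
  have T0 (q : bool) : 0 <= if q then M a' b' else 0 by case: q.
  rewrite /step; case: ifP => [_|]; first by rewrite subrr !addr_ge0 ?T0.
  rewrite /allowed /= subr0 /T1 /T2 /T3 /T4 -/(M a' b') [b' == b]eq_sym [a' == a]eq_sym.
  rewrite inE [b' == b]eq_sym; have Mab := M0 a' b'.
  case: eqP => _ /=; first by rewrite -!addrA lerDl !addr_ge0 ?T0.
  have [_|_] := leP (W a a') c => /=; first by rewrite add0r -addrA lerDl addr_ge0.
  case: eqP => _ /=; first by rewrite !add0r lerDl.
  by rewrite leNgt => /negbFE ->; rewrite !add0r.
under eq_bigr => a' _ do rewrite !big_split /=.
rewrite !big_split /=; apply: lerD; first apply: lerD; first apply: lerD.
- rewrite (bigD1 a) //= [X in _ + X]big1 ?addr0; last first.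
    by move=> a' /negPf ne; rewrite big1 // => b' _; rewrite /T1 ne.
  by rewrite /T1 eqxx /M sum_full_step_fst abF.
- apply: le_trans light; rewrite mulr_natl -sumr_const [leRHS]big_mkcond.
  apply: ler_sum => a' _; rewrite /T2 !inE andbC.
  case: (W a a' <= c) => /=; last by rewrite big1.
  by rewrite /M sum_full_step_fst abF.
- apply: (@le_trans _ _ (\sum_(a' in ends F b) wt b * (c * D)^-1)).
    rewrite [leRHS]big_mkcond; apply: ler_sum => a' _.
    rewrite (bigD1 b) //= [X in _ + X]big1 ?addr0; last first.
      by move=> b' /negPf ne; rewrite /T3 ne andbF.
    rewrite /T3 eqxx andbT; case: ifP => [/M_le|_]; first by move/(_ b); rewrite andbb.
    by case: ifP => // _; rewrite mulr_ge0.
  rewrite sumr_const -[_ *+ _]mulr_natl mulrA ler_piMl //.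
  by rewrite wgt_ends_le ?card_ends_le.
apply: (@le_trans _ _ (\sum_(b' in superheavy b) (codeg b b')%:R * (wt b * (c * D)^-1))).
  rewrite exchange_big [leRHS]big_mkcond; apply: ler_sum => b' _ /=.
  rewrite /T4; case: (b' \in superheavy b); last by rewrite big1 // => a' _; rewrite andbF.
  rewrite mulr_natl -sumr_const [leRHS]big_mkcond; apply: ler_sum => a' _.
  rewrite andbT in_setI; case: ifP => [/M_le//|_].
  by case: ifP => // _; rewrite mulr_ge0.
rewrite -mulr_suml mulrA; apply: ler_wpM2r => //.
apply: le_trans (ler_wpM2r w0 (sum_superheavy abF)) _.
by rewrite -mulrA mulfV ?mulr1 // gt_eqF // (deg_gt0 abF).
Qed.
End FewTriples.
End LadderOperator.

(** * From well-spread rungs to a cycle with all diagonals *)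

Lemma sum_enum_val (V : nmodType) (T : finType) (f : T -> V) :
  \sum_(i < #|T|) f (enum_val i) = \sum_e f e.
Proof. exact: (esym (big_enum_val f)). Qed.

Lemma cdia_of_spread_rungs (R : rcfType) (G : sgraph) (F : {set G * G})
    (D c th eta : R) (P J r : nat) :
  (forall e, e \in F -> adj e.1 e.2) ->
  (forall e, e \in F -> D <= (deg e.2)%:R) -> 0 < D -> 0 < c -> 0 <= th ->
  4 <= th ^+ 2 * D ->
  (forall b b' b'', uniq [:: b; b'; b''] ->
    (#|ends F b :&: ends F b' :&: ends F b''| <= 2)%N) ->
  F != set0 ->
  (forall e, e \in F -> (1 - eta) * (deg e.2)%:R <= #|ends F e.2|%:R) ->
  (forall e, e \in F ->
    #|[set a' in ends F e.2 | wcodeg R F e.1 a' <= c]|%:R * wgt R e.2 <= eta) ->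
  0 <= eta -> D^-1 + 2 * eta + 3 * (c * D)^-1 <= 2 ^- (J + 3) ->
  (#|G| ^ 2 <= 2 ^ P)%N -> (2 * P + 3 <= r * J)%N -> (0 < J)%N ->
  4 * (2 ^ (J + 2) * (P + 3))%:R ^+ 2 * (D^-1 + th) * 2 ^+ r < 1 ->
  exists2 l, (2 <= l)%N & contains G (cdia l).
Proof.
move=> adjF degF D0 c0 th0 thD triple F0 ends_ge light eta0 eps nP PJ J0 small.
pose st := step F c th; pose N := #|{: G * G}|.
pose S : 'M[R]_N := \matrix_(i, j) st (enum_val i) (enum_val j).
pose F' := [set i : 'I_N | enum_val i \in F].
pose inc v : pred 'I_N := fun i => on_rung v (enum_val i).
pose e0 := D^-1 + eta + 3 * (c * D)^-1.
have DV0 : 0 < D^-1 by rewrite invr_gt0.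
have cDV0 : 0 < (c * D)^-1 by rewrite invr_gt0 mulr_gt0.
have e0_ge0 : 0 <= e0 by rewrite /e0; lra.
have rowD e : \sum_e' (full_step R F e e' - st e e') <= e0.
  have [eF|neF] := boolP (e \in F).
    apply: le_trans (forbidden_row adjF degF D0 c0 th0 thD triple eF (light e eF)) _.
    by rewrite /e0; lra.
  rewrite big1 // => e' _; rewrite /st /step.
  by case: ifP => _; rewrite ?subrr // /full_step (negPf neF) subr0.
have symS : S^T = S by apply/matrixP => i j; rewrite !mxE /st stepC.
have S0 i j : 0 <= S i j by rewrite mxE; apply: step_ge0.
have sumS i (Q : pred (G * G)) :
    \sum_(j | Q (enum_val j)) S i j = \sum_(e | Q e) st (enum_val i) e.
  rewrite big_mkcond [RHS]big_mkcond -[RHS]sum_enum_val.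
  by apply: eq_bigr => j _; rewrite mxE.
have rowS i : \sum_j S i j <= 1.
  rewrite (sumS i xpredT); apply: le_trans (full_step_row_le1 adjF degF D0 (enum_val i)).
  by apply: ler_sum => e _; apply: step_le_full.
have inc2 i : (#|[pred v | inc v i]| <= 2)%N.
  apply: (@leq_trans #|[set (enum_val i).1; (enum_val i).2]|); last first.
    by rewrite cards2; case: (_ != _).
  apply/subset_leq_card/subsetP => v; rewrite !inE /inc /on_rung.
  by [].
have incD i j v : S i j != 0 -> inc v i -> ~~ inc v j.
  by rewrite mxE; apply: step_disjoint.
have inc_th v i : \sum_(j | inc v j) S i j <= D^-1 + th.
  by rewrite (sumS i (on_rung v)); apply: step_conflict.
have F'0 : F' != set0.
  have /set0Pn[e eF] := F0; apply/set0Pn; exists (enum_rank e).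
  by rewrite inE enum_rankK.
have rowF i : i \in F' -> 1 - 2 ^- (J + 3) <= \sum_j S i j.
  rewrite inE (sumS i xpredT) => eF; set e := enum_val i in eF *.
  have := rowD e; rewrite sumrB (sum_full_step degF D0) eF.
  have : 1 - eta <= #|ends F e.2|%:R * wgt R e.2.
    have d0 : 0 < (deg e.2)%:R :> R := lt_le_trans D0 (degF e eF).
    by rewrite ler_pdivlMr // ends_ge.
  by rewrite /e0 in eps *; lra.
have suppF i j : S i j != 0 -> j \in F'.
  by rewrite mxE inE; apply: step_mem.
have formS (x : 'I_N -> R) :
    - (3 / 5) * \sum_i x i ^+ 2 <= \sum_i \sum_j S i j * x i * x j.
  pose y e := x (enum_rank e).
  have yE i : x i = y (enum_val i) by rewrite /y enum_valK.
  have sq : \sum_i x i ^+ 2 = \sum_e y e ^+ 2.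
    by rewrite -[RHS]sum_enum_val; apply: eq_bigr => i _; rewrite yE.
  pose M : 'M[R]_N := \matrix_(i, j) full_step R F (enum_val i) (enum_val j).
  have formM : \sum_i \sum_j M i j * x i * x j =
      \sum_e \sum_e' full_step R F e e' * y e * y e'.
    rewrite -[RHS]sum_enum_val; apply: eq_bigr => i _.
    rewrite -[RHS]sum_enum_val; apply: eq_bigr => j _.
    by rewrite mxE -!yE.
  have := full_step_form_ge adjF y; rewrite -formM -sq => formM_ge.
  (* The discarded steps have row sums at most [e0 <= 1 / 16], so by the Schur bound the constant
     -1/2 for the full walk worsens at most to -9/16, still above -3/5. *)
  have : \sum_i \sum_j (M - S) i j * x i * x j <= e0 * \sum_i x i ^+ 2.
    apply: schur_form => [|i j|i].
    - rewrite linearB /= symS; congr (_ - _).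
      by apply/matrixP => i j; rewrite !mxE full_stepC.
    - by rewrite !mxE subr_ge0 step_le_full.
    - apply: le_trans (rowD (enum_val i)); rewrite -[leRHS]sum_enum_val.
      by apply: ler_sum => j _; rewrite !mxE.
  have -> : \sum_i \sum_j (M - S) i j * x i * x j =
      \sum_i \sum_j M i j * x i * x j - \sum_i \sum_j S i j * x i * x j.
    rewrite -sumrB; apply: eq_bigr => i _; rewrite -sumrB; apply: eq_bigr => j _.
    by rewrite !mxE; ring.
  have e0_le : e0 <= 1 / 16.
    apply: (@le_trans _ _ (2 ^- (J + 3))); first by rewrite /e0; lra.
    rewrite -(prednK J0) addSnnS.
    rewrite exprD invfM; apply: (@le_trans _ _ (1 * (2 ^+ 4)^-1)).
      rewrite ler_wpM2r ?invr_ge0 ?exprn_ge0 // invf_le1 ?exprn_gt0 //.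
      by rewrite exprn_ege1 ?ler1n.
    by have -> : 2 ^+ 4 = 16 :> R by [rewrite -natrX]; lra.
  have : e0 * \sum_i x i ^+ 2 <= 1 / 16 * \sum_i x i ^+ 2.
    by apply: ler_wpM2r => //; apply: sumr_ge0 => i _; apply: sqr_ge0.
  have : 0 <= \sum_i x i ^+ 2 by apply: sumr_ge0 => i _; apply: sqr_ge0.
  lra.
have NP : (N <= 2 ^ P)%N by rewrite /N card_prod mulnn.
have th'0 : 0 <= D^-1 + th by rewrite addr_ge0 // ltW.
have [l [w [odd_l l3 wS wd]]] := odd_disjoint_closed_walk symS S0 rowS inc2 incD
  inc_th th'0 F'0 rowF suppF formS NP PJ J0 small.
exists l; first exact: ltnW.
pose a i := (enum_val (w i)).1; pose b i := (enum_val (w i)).2.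
have sideF i : (i < l)%N -> [/\ (a i, b i) \in F, (a (i.+1 %% l)%N, b i) \in F &
    (a i, b (i.+1 %% l)%N) \in F].
  move=> /wS; rewrite mxE /st /step; case: ifP => _; last by rewrite eqxx.
  rewrite /full_step; case: ifP => [/and4P[h1 h2 h3 _] _|]; last by rewrite eqxx.
  by split=> //; rewrite /a /b -surjective_pairing.
apply: (@odd_ladder_cdia G l a b) => // [i /sideF[h _ _]|i /sideF[_ _ h]|i /sideF[_ h _]|i j lt_ij].
- exact: adjF h.
- exact: adjF h.
- by rewrite adj_sym; apply: adjF h.
have := wd (a i) i j lt_ij; have := wd (b i) i j lt_ij.
rewrite /inc /on_rung !eqxx orbT !negb_or => /(_ isT)/andP[h1 h2] /(_ isT)/andP[h3 h4].
by apply/and4P.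
Qed.

(** * Choice of parameters for a dense graph *)

Lemma card_edges_le (G : sgraph) :
  (#|edges G| <= #|[set e : G * G | adj e.1 e.2]|)%N.
Proof.
apply: leq_trans (leq_imset_card (fun e : G * G => [set e.1; e.2]) _).
apply/subset_leq_card/subsetP => _ /imset2P[x y _ xy ->].
by apply/imsetP; exists (x, y); rewrite ?inE.
Qed.

Lemma card_high_rungs (R : realFieldType) (G : sgraph) (D : R) : 0 <= D ->
  #|edges G|%:R - #|G|%:R * D <=
  #|[set e : G * G | adj e.1 e.2 & D <= (deg e.2)%:R]|%:R.
Proof.
move=> D0; rewrite lerBlDr.
apply: le_trans (_ : #|[set e : G * G | adj e.1 e.2]|%:R <= _).
  by rewrite ler_nat card_edges_le.
rewrite !(card_rungs R) mulr_natl -sumr_const -big_split; apply: ler_sum => b _ /=.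
have [le_D|lt_D] := leP D (deg b)%:R.
  apply: ler_wpDr => //; rewrite ler_nat; apply/subset_leq_card/subsetP => a.
  by rewrite !inE /= le_D andbT.
apply: ler_wpDl => //; apply: le_trans (ltW lt_D); rewrite ler_nat.
by apply/subset_leq_card/subsetP => a; rewrite !inE.
Qed.

(** Exponents divisible by 8 keep the approximations [2 ^ (2 * k)] of [n^(1/4)] and [2 ^ k] of
    [n^(1/8)] integral. *)
Lemma exp2_approx n : (0 < n)%N ->
  exists2 k, (n <= 2 ^ (8 * k))%N & (2 ^ (8 * k) <= 256 * n)%N.
Proof.
move=> n_gt0; exists (up_log (2 ^ 8) n); rewrite expnM; first exact: up_logP.
have [n1|n1] := leqP n 1.
  have -> : n = 1%N by apply/eqP; rewrite eqn_leq n1.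
  by rewrite up_log1.
have /andP[/ltnW lo _] := up_log_bounds (isT : 1 < 2 ^ 8)%N n1.
have k0 : (0 < up_log (2 ^ 8) n)%N by rewrite up_log_gt0.
by rewrite -[X in ((2 ^ 8) ^ X)%N](prednK k0) expnS leq_mul2l lo orbT.
Qed.

Lemma sqr_le_exp2 k : ((16 * k + 3) ^ 2 <= 2 ^ (k + 10))%N.
Proof.
apply: (@leq_trans (1024 * 2 ^ k)); last by rewrite expnD mulnC leq_mul2l orbT.
have : ((k + 1) ^ 2 <= 4 * 2 ^ k)%N.
  have [|k3] := leqP k 3; first by case: k => [|[|[|[|k]]]].
  have -> : k = (k - 3 + 3)%N by lia.
  elim: (k - 3)%N => // m; rewrite -!mulnn addSn expnS; nia.
by rewrite -!mulnn; nia.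
Qed.

Lemma dense_contains_cdia (R : rcfType) (G : sgraph) (s q : R) :
  (0 < #|G|)%N -> 0 <= s -> s ^+ 2 = #|G|%:R -> 2 ^+ 92 <= q ->
  q ^+ 2 * s * #|G|%:R <= #|edges G|%:R ->
  exists2 l, (2 <= l)%N & contains G (cdia l).
Proof.
move=> n_gt0 s0 sqr_s q_ge many_edges; set n := #|G| in n_gt0 sqr_s many_edges.
have n0 : 0 < n%:R :> R by rewrite ltr0n.
have s_gt0 : 0 < s.
  by rewrite lt_neqAle s0 andbT; apply: contraTneq n0 => s_eq0; rewrite -sqr_s -s_eq0 expr0n ltxx.
have s_ge1 : 1 <= s.
  by rewrite -(@ler_pXn2r _ 2) ?nnegrE // expr1n sqr_s (ler_nat _ 1).
(* [eps] is the loss of row mass permitted when [J = 35], and [D] is a quarter of the average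
   degree. *)
pose z : R := 2 ^+ 38; pose eps := z^-1; pose D : R := #|edges G|%:R / (2 * n%:R).
have z_ge : 256 <= z.
  by rewrite -[256]/((2 ^ 8)%:R) natrX ler_weXn2l ?ler1n.
have qz : z ^+ 2 <= q.
  by apply: le_trans q_ge; rewrite -exprM; apply: ler_weXn2l; rewrite ?ler1n.
have eps_z : eps * z = 1 by rewrite mulVf // gt_eqF //; lra.
have eps0 : 0 < eps by rewrite invr_gt0; lra.
have q_big : 256 * z <= q by nra.
have epsE : eps = 2 ^- (35 + 3) := erefl _.
clearbody eps; clearbody z.
have q0 : 0 < q by lra.
have D_ge : q ^+ 2 * s / 2 <= D.
  by rewrite /D ler_pdivlMr ?mulr_gt0 //; lra.
have D_geqs : q * s <= D.
  have : 0 <= q * s * (q - 2) by rewrite !mulr_ge0 //; lra.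
  have : q ^+ 2 * s = q * s * q by ring.
  lra.
have D_geq : q <= D.
  by apply: le_trans D_geqs; rewrite -[leLHS]mulr1 ler_wpM2l // ltW.
have D0 : 0 < D by lra.
have edgesE : #|edges G|%:R = 2 * n%:R * D.
  by rewrite /D mulrC divfK // mulf_neq0 ?gt_eqF.
clearbody D.
(* The three losses [D^-1], [2 * eta] and [3 / (c * D)] are at most [eps / 4], [eps / 2] and
   [eps / 4]. *)
pose eta := eps / 4; pose c := 12 / (eps * D).
have c0 : 0 < c by rewrite divr_gt0 // mulr_gt0.
have cD : (c * D)^-1 = eps / 12.
  by rewrite /c; field; rewrite !gt_eqF.
have DV : D^-1 <= eps / 4.
  rewrite -[D^-1]mul1r ler_pdivrMr // mulrAC ler_pdivlMr // mul1r.
  have := ler_wpM2l (ltW eps0) D_geq; have := ler_wpM2l (ltW eps0) q_big; lra.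
have [k n_le n_ge] := exp2_approx n_gt0.
pose K : R := 2 ^+ (2 * k).
have K0 : 0 < K by rewrite exprn_gt0.
have K1 : 1 <= K by rewrite exprn_ege1 ?ler1n.
have K_le : K ^+ 2 <= 16 * s.
  rewrite -(@ler_pXn2r _ 2) ?nnegrE ?mulr_ge0 ?exprn_ge0 //.
  have -> : (K ^+ 2) ^+ 2 = (2 ^ (8 * k))%:R.
    by rewrite natrX /K -!exprM mulnAC.
  have -> : (16 * s) ^+ 2 = (256 * n)%:R by rewrite natrM -sqr_s; ring.
  by rewrite ler_nat.
(* [K] lies between [n^(1/4)] and [4 n^(1/4)], so [th] has order [n^(-1/4)], yet
   [th ^+ 2 * D >= 4]. *)
pose th := 16 / (q * K).
have qK0 : 0 < q * K by rewrite mulr_gt0.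
have th0 : 0 <= th by rewrite divr_ge0 // ltW.
have thD : 4 <= th ^+ 2 * D.
  have -> : th ^+ 2 * D = 256 * D / (q ^+ 2 * K ^+ 2).
    by rewrite /th; field; rewrite !gt_eqF.
  rewrite ler_pdivlMr ?mulr_gt0 ?exprn_gt0 //.
  have := ler_wpM2l (sqr_ge0 q) K_le; lra.
have th'_le : D^-1 + th <= 17 / (q * K).
  suff : D^-1 <= 1 / (q * K) by rewrite /th; lra.
  rewrite div1r lef_pV2 ?posrE //; apply: le_trans D_ge.
  have := ler_wpM2l (sqr_ge0 q) K_le.
  have : 0 <= q * K * (q * K - 32).
    apply: mulr_ge0; first exact: ltW.
    rewrite subr_ge0; apply: (@le_trans _ _ (q * 1)); first by lra.
    by rewrite ler_wpM2l // ltW.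
  have -> : q * K * (q * K - 32) = q ^+ 2 * K ^+ 2 - 32 * (q * K) by ring.
  lra.
have eta_bd : 0 < eta <= 1.
  have : eps <= 1 by have := ler_wpM2l (ltW eps0) z_ge; lra.
  by rewrite /eta => eps1; apply/andP; split; lra.
have [F [F0 sF ends_ge light]] : exists F : {set G * G}, [/\ F != set0,
    F \subset [set e | adj e.1 e.2 & D <= (deg e.2)%:R],
    forall e, e \in F -> (1 - eta) * (deg e.2)%:R <= #|ends F e.2|%:R &
    forall e, e \in F ->
      #|[set a' in ends F e.2 | wcodeg R F e.1 a' <= c]|%:R * wgt R e.2 <= eta].
  apply: well_spread_rungs => //; first exact: ltW.
  have : n%:R * D <= #|[set e : G * G | adj e.1 e.2 & D <= (deg e.2)%:R]|%:R.
    by have := card_high_rungs G (ltW D0); rewrite edgesE -/n; lra.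
  move/(ler_wpM2l (sqr_ge0 eta)); apply: lt_le_trans.
  (* The claim becomes [192 * n < eps ^+ 3 * D ^+ 2]; it holds as [D >= q * s] and
     [eps ^+ 3 * q ^+ 2 >= z >= 256]. *)
  rewrite /c mulrA ltr_pdivrMr ?mulr_gt0 //.
  have -> : eta ^+ 2 * (n%:R * D) * (eps * D) = n%:R * (eps ^+ 3 * D ^+ 2) / 16.
    by rewrite /eta; field.
  have D2 : q ^+ 2 * n%:R <= D ^+ 2.
    by rewrite -sqr_s -exprMn lerXn2r ?nnegrE ?mulr_ge0 // ltW.
  have z4 : z * n%:R <= eps ^+ 3 * (q ^+ 2 * n%:R).
    rewrite mulrA; apply: ler_wpM2r => //.
    have -> : z = eps ^+ 3 * (z ^+ 2) ^+ 2.
      have -> : eps ^+ 3 * (z ^+ 2) ^+ 2 = (eps * z) ^+ 3 * z by ring.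
      by rewrite eps_z expr1n mul1r.
    by rewrite ler_wpM2l ?exprn_ge0 ?lerXn2r ?nnegrE ?sqr_ge0 // ltW.
  have := ler_wpM2l (exprn_ge0 3 (ltW eps0)) D2.
  have := ler_wpM2r (ltW n0) z_ge.
  move=> h1 h2.
  have : 256 * n%:R <= eps ^+ 3 * D ^+ 2 by lra.
  move/(ler_wpM2l (ltW n0)) => h3; have : 0 < n%:R * n%:R :> R by rewrite mulr_gt0.
  by rewrite expr2; lra.
have inE0 e : e \in F -> adj e.1 e.2 /\ D <= (deg e.2)%:R.
  by move/(subsetP sF); rewrite inE => /andP[].
have [/existsP[b /existsP[b' /existsP[b'' /andP[ub tr3]]]]|no_triple] :=
  boolP [exists b, exists b', exists b'', uniq [:: b; b'; b''] &&
    (2 < #|ends F b :&: ends F b' :&: ends F b''|)%N].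
  exists 3%N => //; apply: (K33_cdia tr3 (B := [set x in [:: b; b'; b'']])).
    by rewrite cardsE; move/card_uniqP: ub => ->.
  move=> x y; rewrite !inE => /andP[/andP[xb xb'] xb''].
  by case/or3P => /eqP->; [have := inE0 _ xb | have := inE0 _ xb' | have := inE0 _ xb''] => -[].
have triple b b' b'' : uniq [:: b; b'; b''] ->
    (#|ends F b :&: ends F b' :&: ends F b''| <= 2)%N.
  move=> ub; rewrite leqNgt; apply: contraNN no_triple => tr3.
  by apply/existsP; exists b; apply/existsP; exists b'; apply/existsP; exists b''; rewrite ub.
(* There are at most [2 ^ (16 * k)] pairs of vertices, and [2 * (16 * k) + 3 <= 35 * k.+1]. *)
apply: (@cdia_of_spread_rungs R G F D c th eta (16 * k) 35 k.+1) => //.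
- by move=> e /inE0[].
- by move=> e /inE0[].
- by case/andP: eta_bd => /ltW.
- by rewrite cD -epsE /eta; lra.
- have -> : (16 * k = 8 * k * 2)%N by rewrite mulnAC.
  by rewrite expnM leq_exp2r.
- by rewrite mulnA [(k.+1 * 35)%N]mulSn addnC leq_add // mulnC leq_mul2l orbT.
(* The squared length costs about [2 ^ k] and the slow decay another [2 ^ k]; both cancel against
   [K = 2 ^ (2 * k)], leaving a constant over [q]. *)
have : 4 * (2 ^ 37 * (16 * k + 3))%:R ^+ 2 * (D^-1 + th) * 2 ^+ k.+1 <=
    17 * 2 ^+ 87 / q :> R.
  have -> : 17 * 2 ^+ 87 / q = 4 * (2 ^+ 74 * 2 ^+ (k + 10)) * (17 / (q * K)) * 2 ^+ k.+1 :> R.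
    have -> : 2 ^+ 87 = 2 ^+ 2 * 2 ^+ 74 * 2 ^+ 10 * 2 :> R by rewrite -!exprD -exprSr.
    have -> : K = 2 ^+ k * 2 ^+ k by rewrite /K mul2n -addnn exprD.
    rewrite [2 ^+ (k + 10)]exprD [2 ^+ k.+1]exprS; have := exprn_gt0 k (ltr0Sn R 1).
    move: (2 ^+ 74) (2 ^+ 10) (2 ^+ k) => u v t t0.
    by field; rewrite !gt_eqF.
  apply: ler_wpM2r; first exact: exprn_ge0.
  apply: ler_pM => //; [by rewrite mulr_ge0 ?sqr_ge0 | by rewrite addr_ge0 // invr_ge0 ltW |].
  apply: ler_wpM2l => //; rewrite natrM exprMn natrX -exprM.
  by apply: ler_wpM2l; rewrite ?exprn_ge0 // -!natrX ler_nat sqr_le_exp2.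
move/le_lt_trans; apply; rewrite ltr_pdivrMr // mul1r; apply: lt_le_trans q_ge.
rewrite (_ : 92 = 5 + 87)%N // exprD ltr_pM2r ?exprn_gt0 //.
by rewrite -natrX ltr_nat.
Qed.

Theorem theorem1p1 (R : realType) :
  exists2 C : R, 0 < C &
    forall (n : nat) (G : sgraph), (0 < n)%N -> #|G| = n ->
      C * n%:R `^ (3 / 2) <= #|edges G|%:R ->
      exists2 l : nat, (2 <= l)%N & contains G (cdia l).
Proof.
exists ((2 ^+ 92) ^+ 2); first by rewrite !exprn_gt0.
move=> n G n_gt0 card_G many_edges.
apply: (@dense_contains_cdia R G (Num.sqrt n%:R) (2 ^+ 92)) => //.
- by rewrite card_G.
- by rewrite sqrtr_ge0.
- by rewrite sqr_sqrtr ?card_G.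
rewrite -mulrA card_G; apply: le_trans many_edges; rewrite ler_wpM2l ?sqr_ge0 //.
have -> : 3 / 2 = 2^-1 + 1 :> R by lra.
by rewrite powRD ?powR12_sqrt ?powRr1 // pnatr_eq0 -lt0n n_gt0 implybT.
Qed.
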